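(* Let $\mathcal G$ be a core input-output network with homeostasis pattern network $\mathcal P$ and structural pattern network $\mathcal P_{\mathcal S}$. A backbone node $\widetilde{\mathcal L}_j\in\mathcal P_{\mathcal S}$ induces every node of $\mathcal P_{\mathcal S}$ strictly downstream from $\widetilde{\mathcal L}_j$, but no other nodes of $\mathcal P_{\mathcal S}$.
   Context: NETWORKS. An input-output network $\mathcal G$ is a finite directed graph with two distinct distinguished nodes, the input node $\iota$ and the output node $o$. It is core if every node is downstream from $\iota$ (there is a directed path from $\iota$ to it) and upstream from $o$. INDUCTION. Each node $j$ carries a variable $x_j\in\mathbb R$. An admissible system is $\dot X=f(X,\mathcal I)$ with $f$ smooth, where the real parameter $\mathcal I$ appears only in $f_\iota$, and $f_j$ depends only on $x_j$ and on those $x_\ell$ with an arrow $\ell\to j$. Write $f_{j,\ell}=\partial f_j/\partial x_\ell$; for $j\ne\ell$, $f_{j,\ell}\equiv 0$ precisely when there is no arrow $\ell\to j$. If $X_0$ is a hyperbolic equilibrium at $\mathcal I_0$, there is a unique family of equilibria $X(\mathcal I)$ near $\mathcal I_0$ with $X(\mathcal I_0)=X_0$; a node $\kappa$ is homeostatic at $(X_0,\mathcal I_0)$ if $x_\kappa'(\mathcal I_0)=0$. The homeostasis matrix $H$ is the Jacobian $J=(f_{j,\ell})$ with the row of $\iota$ and the column of $o$ deleted. There are permutation matrices $P,Q$ such that $PHQ$ is block upper triangular with square diagonal blocks $B_1,\dots,B_m$ that cannot be further block triangularized (entries $f_{j,\ell}$ regarded as independent indeterminates); these are the homeostasis blocks.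 The homeostasis subnetwork $\mathcal K_\eta$ of $B_\eta$ has as nodes all $p,q$ such that $f_{p,q}$ is a nonzero entry of $B_\eta$, and as arrows the corresponding $q\to p$ with $p\ne q$. $\mathcal K_\eta$ is homeostasis inducing at $(X_0,\mathcal I_0)$ if $\det B_\eta=0$ there. $\mathcal K\Rightarrow\kappa$ ($\mathcal K$ induces node $\kappa$) means: generically for admissible $f$, $\kappa$ is homeostatic whenever $\mathcal K$ is homeostasis inducing. Here ''generically'' means: except when the partial derivatives at $(X_0,\mathcal I_0)$ satisfy an additional polynomial equation not vanishing identically on the set where the determinant of the block of $\mathcal K$ is zero. For a set $\mathcal N$ of nodes (or a subnetwork), $\mathcal K\Rightarrow\mathcal N$ means $\mathcal K\Rightarrow\kappa$ for every $\kappa\in\mathcal N$. SIMPLE NODES. A simple path visits each of its nodes once; $\kappa_1\rightsquigarrow\kappa_2$ denotes a simple path from $\kappa_1$ to $\kappa_2$. An $\iota o$-simple path is a simple path from $\iota$ to $o$. A node is simple if it lies on some $\iota o$-simple path, appendage otherwise, and super-simple if it lies on every $\iota o$-simple path. The super-simple nodes are totally ordered, $\iota=\rho_0\prec\rho_1\prec\dots\prec\rho_{q+1}=o$, by order of appearance on any $\iota o$-simple path. If there are a super-simple $\rho$ and an $\iota o$-simple path $\iota\rightsquigarrow\sigma_1\rightsquigarrow\rho\rightsquigarrow\sigma_2\rightsquigarrow o$, then $\sigma_1\prec\rho$, $\rho\prec\sigma_2$, $\sigma_1\prec\sigma_2$. A transitive component is a strongly connected component. For an $\iota o$-simple path $S$,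 the complementary subnetwork $C_S$ consists of all nodes not in $S$ and all arrows between them. An appendage node $\tau$ is super-appendage if for each $C_S$ containing $\tau$, the transitive component of $\tau$ in $C_S$ consists only of appendage nodes. SUBNETWORKS. For $1\le j\le q+1$: the simple subnetwork $\mathcal L_j''$ consists of the simple nodes $\sigma$ with $\rho_{j-1}\prec\sigma\prec\rho_j$ (possibly none); $T_j$ is the set of appendage, non-super-appendage nodes $\tau$ linked to $\mathcal L_j''$, i.e. such that for some $C_S$ the transitive component of $\tau$ in $C_S$ is the union of $\tau$, (at least one) nodes of $\mathcal L_j''$, and non-super-appendage nodes; the augmented simple subnetwork is $\mathcal L_j'=\mathcal L_j''\cup T_j$; the structural subnetwork is $\mathcal L_j=\{\rho_{j-1}\}\cup\mathcal L_j'\cup\{\rho_j\}$, each with all arrows between its nodes. An appendage subnetwork $\mathcal A$ is a transitive component of the subnetwork of super-appendage nodes. It is known that the homeostasis subnetworks of $\mathcal G$ are the structural and the appendage subnetworks. PATTERN NETWORK (part used here). $\mathcal P_{\mathcal S}$ is the chain $\iota=\rho_0\to\widetilde{\mathcal L}_1\to\rho_1\to\widetilde{\mathcal L}_2\to\dots\to\widetilde{\mathcal L}_{q+1}\to\rho_{q+1}=o$, whose nodes are the super-simple nodes and the backbone nodes $\widetilde{\mathcal L}_j$ (representing $\mathcal L_j'$ as a single node, even if $\mathcal L_j'$ is empty). It is part of the homeostasis pattern network $\mathcal P$. The homeostasis subnetwork corresponding to $\widetilde{\mathcal L}_j$ is the structural subnetwork $\mathcal L_j$. ''Strictly downstream''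 in $\mathcal P_{\mathcal S}$ means strictly later in this chain. A backbone node $\widetilde{\mathcal L}_j$ induces a backbone node $\widetilde{\mathcal L}_k$ iff $\mathcal L_j\Rightarrow\mathcal L_k$, and induces a super-simple node $\rho$ iff $\mathcal L_j\Rightarrow\rho$. *)

(* Defs.v *)
From mathcomp Require Import all_boot all_order all_algebra.
From mathcomp Require Import complex.
(* Not imported: its notations clash with those of MathComp-Analysis. *)
From mathcomp Require mpoly.
From mathcomp Require Import all_classical all_reals all_analysis.

Set Implicit Arguments.
Unset Strict Implicit.
Unset Printing Implicit Defensive.

Import Order.TTheory GRing.Theory Num.Theory.
Import numFieldNormedType.Exports.

Local Open Scope ring_scope.

(** * Networks *)

(* [arrow G l j] is the arrow l -> j. Self-arrows are irrelevant below: every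
   node is allowed to depend on itself anyway. *)
Record network (n : nat) := Network {
  arrow : rel 'I_n;
  input : 'I_n;
  output : 'I_n;
  input_neq_output : input != output
}.

Section Combinatorics.
Variables (n : nat) (G : network n).
Implicit Types (p : seq 'I_n) (v w tau sigma rho : 'I_n).

Definition core := forall v,
  connect (arrow G) (input G) v /\ connect (arrow G) v (output G).

(* [p] lists all the nodes of the path, endpoints included. *)
Definition io_simple_path p :=
  exists p', [/\ p = input G :: p', path (arrow G) (input G) p',
                 last (input G) p' = output G & uniq p].

Definition simple_node v := exists2 p, io_simple_path p & v \in p.

Definition appendage_node v := ~ simple_node v.

Definition super_simple_node v := forall p, io_simple_path p -> v \in p.

(* sigma1 ~> r ~> sigma2 along some io-simple path with r super-simple; the
   non-strict bounds cover the cases r = sigma1 and r = sigma2. *)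
Definition prec sigma1 sigma2 := exists p r,
  [/\ io_simple_path p, sigma1 \in p, sigma2 \in p & super_simple_node r] /\
  [/\ (index sigma1 p <= index r p)%N, (index r p <= index sigma2 p)%N
    & (index sigma1 p < index sigma2 p)%N].

Definition complement_arrow p : rel 'I_n :=
  fun v w => [&& arrow G v w, v \notin p & w \notin p].

(* Meaningful for tau \notin p. *)
Definition transitive_component p tau w :=
  connect (complement_arrow p) tau w /\ connect (complement_arrow p) w tau.

Definition super_appendage_node tau :=
  appendage_node tau /\
  forall p, io_simple_path p -> tau \notin p ->
    forall w, transitive_component p tau w -> appendage_node w.

Definition non_super_appendage_node tau :=
  appendage_node tau /\ ~ super_appendage_node tau.

Definition super_simple_order q (rho : 'I_q.+2 -> 'I_n) :=
  (forall v, super_simple_node v <-> exists k, v = rho k) /\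
  (forall k l : 'I_q.+2, (k < l)%N -> prec (rho k) (rho l)).

(* [j : 'I_q.+1] is counted from 0, so the structural subnetwork of index j lies
   between the super-simple nodes [rho_pred j] and [rho_succ j]. *)
Section Subnetworks.
Variables (q : nat) (rho : 'I_q.+2 -> 'I_n).
Implicit Type j : 'I_q.+1.

Definition rho_pred j := rho (widen_ord (leqnSn q.+1) j).
Definition rho_succ j := rho (lift ord0 j).

Definition simple_subnetwork j sigma :=
  [/\ simple_node sigma, prec (rho_pred j) sigma & prec sigma (rho_succ j)].

Definition linked_to j tau :=
  non_super_appendage_node tau /\
  exists p, [/\ io_simple_path p, tau \notin p,
    exists2 w, transitive_component p tau w & simple_subnetwork j w
  & forall w, transitive_component p tau w ->
      [\/ w = tau, simple_subnetwork j w | non_super_appendage_node w]].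

Definition augmented_simple_subnetwork j v :=
  simple_subnetwork j v \/ linked_to j v.

Definition structural_subnetwork j v :=
  [\/ v = rho_pred j, augmented_simple_subnetwork j v | v = rho_succ j].

End Subnetworks.

(** ** Homeostasis blocks *)

(* The entries f_{j,l} that are indeterminates; the others are 0. *)
Definition nonzero_entry j l := (j == l) || arrow G l j.

(* A block is given by its set of rows and its set of columns. *)
Definition block : Type := ({set 'I_n} * {set 'I_n})%type.

Definition nonempty_square (B : block) := (0 < #|B.1|)%N && (#|B.1| == #|B.2|).

(* B1 precedes B2 on the diagonal: the entries at the rows of B2 and the columns
   of B1, which are below the diagonal, are 0. *)
Definition upper_triangular (B1 B2 : block) :=
  [&& [disjoint B1.1 & B2.1], [disjoint B1.2 & B2.2] &
      [forall j in B2.1, forall l in B1.2, ~~ nonzero_entry j l]].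

(* Up to permutations of its rows and of its columns, the submatrix [M] is block
   upper triangular with diagonal blocks [bs], in this order. *)
Definition block_triangularization (M : block) (bs : seq block) :=
  [/\ all nonempty_square bs,
      pairwise upper_triangular bs,
      \bigcup_(B <- bs) B.1 = M.1 & \bigcup_(B <- bs) B.2 = M.2].

Definition irreducible_block (B : block) :=
  forall bs, block_triangularization B bs -> size bs = 1%N.

Definition homeostasis_matrix : block := ([set~ input G], [set~ output G]).

Definition homeostasis_block (B : block) :=
  exists bs, [/\ block_triangularization homeostasis_matrix bs,
                 {in bs, forall B', irreducible_block B'} & B \in bs].

Definition block_nodes (B : block) v :=
  exists w, [/\ v \in B.1, w \in B.2 & nonzero_entry v w] \/
            [/\ w \in B.1, v \in B.2 & nonzero_entry w v].

End Combinatorics.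

(** * Admissible systems *)

Section Dynamics.
Variables (R : realType) (n : nat) (G : network n).

(* C^oo: all iterated directional derivatives are differentiable. *)
Definition smooth (V W : normedModType R) (f : V -> W) :=
  forall (vs : seq V) (x : V),
    differentiable (foldr (fun v (g : V -> W) => 'D_v g) f vs) x.

Definition system : Type := 'rV[R]_n -> R -> 'rV[R]_n.
Implicit Types (f : system) (X : 'rV[R]_n) (I : R) (J : 'M[R]_n).

Definition partial f (j l : 'I_n) X I : R :=
  'D_(delta_mx 0 l : 'rV[R]_n) (fun Y => f Y I 0 j) X.

Definition jacobian_at f X I : 'M[R]_n := \matrix_(j, l) partial f j l X I.

Definition input_derivative f X I : R := derive1 (fun t => f X t 0 (input G)) I.

Record admissible f : Prop := {
  admissible_smooth :
    smooth (fun z : ('rV[R]_n * R^o)%type => f z.1 z.2);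
  admissible_input :
    forall (j : 'I_n) (X : 'rV[R]_n) (I I' : R), j != input G ->
      f X I 0 j = f X I' 0 j;
  admissible_arrows :
    forall (j : 'I_n) (X Y : 'rV[R]_n) (I : R),
      (forall l : 'I_n, nonzero_entry G j l -> X 0 l = Y 0 l) ->
      f X I 0 j = f Y I 0 j;
  admissible_partial :
    forall j l : 'I_n, j != l ->
      (forall X I, partial f j l X I = 0) <-> ~~ arrow G l j
}.

Definition hyperbolic_equilibrium f X0 I0 :=
  f X0 I0 = 0 /\
  forall z : complex R,
    eigenvalue (map_mx (real_complex R) (jacobian_at f X0 I0)) z ->
    complex.Re z != 0.

Definition equilibrium_family f X0 I0 (X : R -> 'rV[R]_n) :=
  [/\ X I0 = X0,
      \forall I \near I0, derivable X I 1
    & \forall I \near I0, f (X I) I = 0].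

(* At a hyperbolic equilibrium there is exactly one germ of such a family, by
   the implicit function theorem. *)
Definition homeostatic f X0 I0 (kappa : 'I_n) :=
  forall X : R -> 'rV[R]_n, equilibrium_family f X0 I0 X ->
    derive1 (fun I => X I 0 kappa) I0 = 0.

(* Only defined up to sign, the rows and columns being enumerated separately. *)
Definition block_det (B : block n) J : R :=
  \det (\matrix_(i < #|B.1|, k < #|B.1|)
          J (enum_val i) (nth (enum_val i) (enum B.2) k)).

Definition homeostasis_inducing f X0 I0 (B : block n) :=
  block_det B (jacobian_at f X0 I0) = 0.

(* The possible values of the partial derivatives f_{j,l}. *)
Definition network_matrix J := forall j l, ~~ nonzero_entry G j l -> J j l = 0.

(* The variables are the f_{j,l}, followed by the derivative of f_iota with
   respect to the parameter. *)
Definition eval_partials (P : mpoly.mpoly (n * n + 1) R) J (a : R) : R :=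
  mpoly.meval (fun k => row_mx (mxvec J) (a%:M : 'M[R]_1) 0 k) P.

Definition block_induces (B : block n) (kappa : 'I_n) :=
  exists P : mpoly.mpoly (n * n + 1) R,
    (exists J a,
       [/\ network_matrix J, block_det B J = 0 & eval_partials P J a != 0]) /\
    (forall f X0 I0,
       admissible f -> hyperbolic_equilibrium f X0 I0 ->
       homeostasis_inducing f X0 I0 B ->
       eval_partials P (jacobian_at f X0 I0) (input_derivative f X0 I0) != 0 ->
       homeostatic f X0 I0 kappa).

(* Subnetworks are given by their sets of nodes. *)
Definition induces (K : 'I_n -> Prop) (kappa : 'I_n) :=
  exists B, [/\ homeostasis_block G B,
                forall v, block_nodes G B v <-> K v
              & block_induces B kappa].

Definition induces_all (K N : 'I_n -> Prop) :=
  forall kappa, N kappa -> induces K kappa.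

End Dynamics.

(** * The structural pattern network *)

Inductive pattern_node (q : nat) :=
| SuperSimple of 'I_q.+2
| Backbone of 'I_q.+1.

Definition position q (v : pattern_node q) : nat :=
  match v with
  | SuperSimple k => k.*2
  | Backbone j => j.*2.+1
  end.

Definition strictly_downstream q (v w : pattern_node q) :=
  (position w < position v)%N.

Definition backbone_induces (R : realType) n (G : network n) q
    (rho : 'I_q.+2 -> 'I_n) (j : 'I_q.+1) (v : pattern_node q) :=
  match v with
  | SuperSimple k => induces R G (structural_subnetwork G rho j) (rho k)
  | Backbone k =>
      induces_all R G (structural_subnetwork G rho j)
        (structural_subnetwork G rho k)
  end.

(* Main.v *)
From HB Require Import structures.
Require Import Defs.
From mathcomp Require Import all_boot all_order all_algebra.
From mathcomp Require Import complex.
From mathcomp Require mpoly.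
From mathcomp Require Import all_classical all_reals all_analysis.
From mathcomp Require Import ring zify.
(* Last, so that the names shared with classical sets refer to finite sets. *)
From mathcomp Require Import fintype finset.

Set Implicit Arguments.
Unset Strict Implicit.
Unset Printing Implicit Defensive.

Import Order.TTheory GRing.Theory Num.Theory.
Import numFieldNormedType.Exports.

(** A nonzero term in the expansion of the determinant of the homeostasis
    matrix is a bijection from columns to rows, that is, an injective map [m] of
    the nodes to themselves with [m o = iota] and, for [c <> o], either
    [m c = c] or an arrow [c -> m c] ([matching]).  Following an io-simple path
    and fixing the other nodes gives such a map; conversely the orbit of [iota]
    is an io-simple path, and [m] permutes the remaining nodes.  Let [c] depend
    on [c'] when the entry in row [m c'] and column [c] is nonzero.  A set of
    columns is closed under this relation exactly when its columns have nonzero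
    entries in as few rows as there are columns, and this does not mention [m].
    Hence reachability along dependences, and its strongly connected classes
    [K], are the same for all matchings, and the homeostasis blocks are exactly
    the pairs [(m K, K)] ([class_homeostasis_block], [homeostasis_block_class]).

    The freedom to change [m] identifies the block of the class of [rho_j] with
    the structural subnetwork [L_j] ([structural_subnetwork_class]).  Comparing
    an io-simple path through a node with one that avoids it shows that a node
    which is not super-simple is equivalent to its predecessor on any path
    ([next_class]), whereas the nodes reached from [iota] without visiting a
    super-simple node form a closed set ([avoiding_stable]).  So the class of
    [rho_j] meets every io-simple path exactly from [rho_j] up to the node
    before [rho_(j+1)].  A super-appendage node cannot belong to it, since
    otherwise rotating [m] along a cycle of dependences would give an io-simple
    path off which its transitive component is larger, although this component
    must be the same off every io-simple path ([super_appendage_class]).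

    Differentiating the equilibrium equation, the response [x'] satisfies
    [J x' = b e_iota] for some scalar [b].  If the block of [rho_j] is singular,
    some nonzero [y] supported on the columns reachable from [rho_j] has [J y]
    proportional to [e_iota] ([singular_class_kernel]); as [J] is invertible,
    [x'] is a multiple of [y].  Therefore every node that is not reachable from
    [rho_j] is homeostatic, with no genericity needed, and all nodes of later
    structural subnetworks are of this kind.

    For [k <= j] no polynomial [P] that is nonzero somewhere on the hypersurface
    [det B = 0] can force [rho_k] to be homeostatic.  The matrices whose block
    kills a given vector [y] form a linear space.  Irreducibility of the block
    allows one to move the point where [P] is nonzero, along lines inside the
    hypersurface, until [y] has no zero entry on the block ([full_kernel]).
    Inside the resulting linear space an explicit matrix, the identity minus a
    weighted tree rooted at [iota], is hyperbolic and gives [rho_k] a nonzero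
    response ([tree_matrix]).  Both properties hold where certain polynomials do
    not vanish, so they hold together with [P <> 0] at some point of the line
    joining the two matrices ([generic_point]).  Such a point is the Jacobian of
    an admissible quadratic system whose quadratic terms vanish on the line
    spanned by the response, which makes that line an explicit family of
    equilibria ([realization]). *)

(** * Matchings and homeostasis blocks *)

Section Matchings.
Variables (n : nat) (G : network n).
Implicit Types (m : 'I_n -> 'I_n) (c u v : 'I_n) (C D K : {set 'I_n}).
Implicit Types (s bs : seq (block n)) (B : block n).

(** The bijection matches the columns, which are the nodes other than [o], with
    the rows, which are the nodes other than [iota].  Setting [m o = iota]
    turns it into a permutation of the nodes. *)
Record matching m : Prop := Matching {
  matching_inj : injective m;
  matching_output : m (output G) = input G;
  matching_entry : forall c, c != output G -> nonzero_entry G (m c) c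
}.

(** Contracting each column [c] with its row [m c] turns the homeostasis matrix
    into a square matrix indexed by columns; this is its digraph. *)
Definition depends m : rel 'I_n := fun c c' =>
  [&& c != output G, c' != output G & nonzero_entry G (m c') c].

Definition stable m C := output G \notin C /\
  forall c c', c \in C -> depends m c c' -> c' \in C.

Definition class m c : {set 'I_n} :=
  [set c' | connect (depends m) c c' && connect (depends m) c' c].

Definition class_block m c : block n := (m @: class m c, class m c).

Lemma matching_input m c : matching m -> c != output G -> m c != input G.
Proof.
move=> Hm; apply: contraNneq => mc; apply/eqP/(matching_inj Hm).
by rewrite mc (matching_output Hm).
Qed.

Lemma mem_matching_image m C c : matching m -> (m c \in m @: C) = (c \in C).
Proof. by move=> Hm; rewrite mem_imset //; exact: matching_inj. Qed.

(** The rows met by a stable set are those in [m @: C]; any other matching sends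
    the columns of [C] injectively into these rows, hence onto them. *)
Lemma stable_image m m' C : matching m -> matching m' -> stable m C ->
  m' @: C = m @: C.
Proof.
move=> Hm Hm' [oC CC]; apply/eqP; rewrite eqEcard.
rewrite !card_imset ?leqnn ?andbT; try exact: matching_inj.
apply/subsetP => _ /imsetP[c cC ->].
have co : c != output G by apply: contraNneq oC => <-.
have [c' c'E] : exists c', m c' = m' c.
  by have [g _ gK] := injF_bij (matching_inj Hm); exists (g (m' c)).
rewrite -c'E; apply: imset_f; apply: (CC c) => //; apply/and3P; split => //.
  apply: contraTneq (matching_input Hm' co) => c'o.
  by rewrite -c'E c'o (matching_output Hm) eqxx.
by rewrite c'E; exact: matching_entry.
Qed.

Lemma stable_matching m m' C : matching m -> matching m' -> stable m C ->
  stable m' C.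
Proof.
move=> Hm Hm' sC; have mE := stable_image Hm Hm' sC.
have [oC CC] := sC; split=> // c c' cC /and3P[co c'o e].
have [d dE] : exists d, m d = m' c'.
  by have [g _ gK] := injF_bij (matching_inj Hm); exists (g (m' c')).
have dC : d \in C.
  apply: (CC c) => //; apply/and3P; split => //; last by rewrite dE.
  apply: contraTneq (matching_input Hm' c'o) => d_o.
  by rewrite -dE d_o (matching_output Hm) eqxx.
by rewrite -(mem_matching_image _ _ Hm') mE -dE mem_matching_image.
Qed.

Lemma connect_stable m C c c' : stable m C -> c \in C ->
  connect (depends m) c c' -> c' \in C.
Proof.
move=> [_ CC] cC /connectP[p pp ->]; elim: p c cC pp => //= d p IH c cC.
by case/andP => cd; apply: IH; apply: CC cd.
Qed.

Lemma connect_output m c c' : connect (depends m) c c' ->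
  (c == output G) = (c' == output G).
Proof.
case/connectP=> p pp ->; elim: p c pp => //= d p IH c /andP[/and3P[co d_o _]].
by move/IH <-; rewrite (negPf co) (negPf d_o).
Qed.

Lemma stable_reach m c : c != output G ->
  stable m [set c' | connect (depends m) c c'].
Proof.
move=> co; split; first by rewrite inE; apply: contraNN co => /connect_output ->.
move=> d d'; rewrite !inE => cd dd'; apply: connect_trans cd _.
exact: connect1.
Qed.

(** The columns reachable from [c] for [m'] form a stable set, and stability does
    not depend on the matching. *)
Lemma connect_matching m m' c c' : matching m -> matching m' ->
  connect (depends m) c c' -> connect (depends m') c c'.
Proof.
move=> Hm Hm' cc'; have [co|co] := eqVneq c (output G).
  have := connect_output cc'; rewrite co eqxx => /esym/eqP ->.
  exact: connect0.
have := connect_stable (stable_matching Hm' Hm (stable_reach m' co)) _ cc'.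
by rewrite !inE; apply; exact: connect0.
Qed.

Lemma class_matching m m' c : matching m -> matching m' ->
  class m c = class m' c.
Proof.
move=> Hm Hm'; apply/setP => d; rewrite !inE.
by apply/andP/andP => -[cd dc]; split;
  by [exact: (connect_matching _ _ cd)|exact: (connect_matching _ _ dc)].
Qed.

Lemma class_refl m c : c \in class m c.
Proof. by rewrite inE connect0. Qed.

Lemma class_eq m c d : d \in class m c -> class m d = class m c.
Proof.
rewrite inE => /andP[cd dc]; apply/setP => e; rewrite !inE.
apply/andP/andP => -[H1 H2]; split.
- exact: connect_trans cd H1.
- exact: connect_trans H2 dc.
- exact: connect_trans dc H1.
- exact: connect_trans H2 cd.
Qed.

Lemma class_output m c : c != output G -> output G \notin class m c.
Proof. by move=> co; rewrite inE; apply: contraNN co => /andP[/connect_output ->]. Qed.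

(** If [m2 y = m1 x], then [x] and [y] depend on each other, one way through the
    entry of [m1] at [x], the other way through that of [m2] at [y]. *)
Lemma class_image m m' c : matching m -> matching m' -> c != output G ->
  m @: class m c = m' @: class m' c.
Proof.
have half m1 m2 : matching m1 -> matching m2 -> c != output G ->
    m1 @: class m1 c \subset m2 @: class m2 c.
  move=> H1 H2 co; apply/subsetP => _ /imsetP[x xc ->].
  have xo : x != output G by apply: contraNneq (class_output m1 co) => <-.
  have [y yE] : exists y, m2 y = m1 x.
    by have [g _ gK] := injF_bij (matching_inj H2); exists (g (m1 x)).
  have yo : y != output G.
    apply: contraTneq (matching_input H1 xo) => yo.
    by rewrite -yE yo (matching_output H2) eqxx.
  have xy : connect (depends m2) x y.
    by apply/connect1/and3P; rewrite xo yo yE; split=> //; exact: matching_entry.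
  have yx : connect (depends m2) y x.
    apply: (connect_matching H1 H2); apply/connect1/and3P; split=> //.
    by rewrite -yE; exact: matching_entry.
  rewrite -yE imset_f //; move: xc; rewrite (class_matching c H1 H2) !inE.
  case/andP=> cx xc; rewrite (connect_trans cx xy).
  exact: connect_trans yx xc.
by move=> Hm Hm' co; apply/eqP; rewrite eqEsubset !half.
Qed.

Lemma mem_bigcup_block (F : block n -> {set 'I_n}) s x :
  (x \in \bigcup_(B <- s) F B) = has (fun B => x \in F B) s.
Proof. by elim: s => [|B s IH]; rewrite ?big_nil ?inE // big_cons inE IH. Qed.

(** The diagonal blocks are square, and disjoint in rows and in columns. *)
Lemma triangular_card s : all (@nonempty_square n) s ->
  pairwise (upper_triangular G) s ->
  #|\bigcup_(B <- s) B.1| = #|\bigcup_(B <- s) B.2|.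
Proof.
elim: s => [|B s IH] /=; first by rewrite !big_nil.
case/andP=> /andP[_ /eqP cB] sq /andP[/allP ut pw].
rewrite !big_cons !cardsU cB IH //.
congr (_ + _ - _)%N.
have -> : B.1 :&: \bigcup_(j <- s) j.1 = set0.
  apply/eqP; rewrite setI_eq0 disjoint_sym disjoint_subset; apply/subsetP => x.
  rewrite mem_bigcup_block => /hasP[B' /ut/and3P[d _ _] xB'].
  by rewrite inE (disjointFl d).
have -> : B.2 :&: \bigcup_(j <- s) j.2 = set0 => //.
apply/eqP; rewrite setI_eq0 disjoint_sym disjoint_subset; apply/subsetP => x.
rewrite mem_bigcup_block => /hasP[B' /ut/and3P[_ d _] xB'].
by rewrite inE (disjointFl d).
Qed.

(** The columns of the first diagonal blocks only meet the rows of these blocks,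
    which are equally many; so the matching exchanges the two. *)
Lemma prefix_stable m D s1 s2 : matching m -> output G \notin D ->
  block_triangularization G (m @: D, D) (s1 ++ s2) ->
  let C := \bigcup_(B <- s1) B.2 in
  [/\ C \subset D, m @: C = \bigcup_(B <- s1) B.1 &
      forall c c', c \in C -> c' \in D -> depends m c c' -> c' \in C].
Proof.
move=> Hm oD [sq pw rows cols] C; simpl in rows, cols.
have CD : C \subset D.
  by apply/subsetP => x xC; rewrite -cols big_cat inE xC.
have nz c u : c \in C -> u \in m @: D -> nonzero_entry G u c ->
    u \in \bigcup_(B <- s1) B.1.
  move=> cC; rewrite -rows big_cat inE => /orP[//|].
  rewrite mem_bigcup_block => /hasP[B2 B2s uB2].
  move: cC; rewrite mem_bigcup_block => /hasP[B1 B1s cB1].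
  move: pw; rewrite pairwise_cat => /and3P[/allrelP pw _ _].
  have /and3P[_ _ /forall_inP] := pw _ _ B1s B2s.
  by move=> /(_ _ uB2)/forall_inP/(_ _ cB1)/negPf ->.
have mC : m @: C = \bigcup_(B <- s1) B.1.
  apply/eqP; rewrite eqEcard card_imset; last exact: matching_inj.
  apply/andP; split.
    apply/subsetP => _ /imsetP[c cC ->]; apply: (nz c) => //.
      exact/imset_f/(subsetP CD).
    by apply: matching_entry => //; apply: contraNneq oD => <-; exact: (subsetP CD).
  rewrite triangular_card //; first by move: sq; rewrite all_cat => /andP[].
  by move: pw; rewrite pairwise_cat => /and3P[].
split=> // c c' cC c'D /and3P[_ _ e]; rewrite -(mem_matching_image _ _ Hm) mC.
by apply: (nz c) => //; exact: imset_f.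
Qed.

(** A strongly connected class is fully indecomposable: a path between two of its
    columns stays inside. *)
Lemma class_closed m c X : X != set0 -> X \subset class m c ->
  (forall x x', x \in X -> x' \in class m c -> depends m x x' -> x' \in X) ->
  X = class m c.
Proof.
move=> /set0Pn[x xX] XK XX; apply/eqP; rewrite eqEsubset XK.
apply/subsetP => y yK; have xK := subsetP XK x xX.
have : connect (depends m) x y.
  move: xK yK; rewrite !inE => /andP[_ xc] /andP[cy _].
  exact: connect_trans xc cy.
case/connectP=> p; elim: p x xX xK => [|z p IH] x xX xK /=; first by move=> _ ->.
case/andP=> xz pz yE.
have zK : z \in class m c.
  move: xK yK; rewrite !inE => /andP[cx _] /andP[_ yc].
  rewrite (connect_trans cx (connect1 xz)); apply: connect_trans yc.
  by apply/connectP; exists p.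
by apply: (IH z) => //; exact: (XX x).
Qed.

Lemma irreducible_class m c : matching m -> c != output G ->
  irreducible_block G (class_block m c).
Proof.
move=> Hm co [|B [|B' bs]] tri //.
  case: tri => _ _ _; rewrite big_nil => /setP/(_ c).
  by rewrite class_refl inE.
have oD := class_output m co.
have [] := prefix_stable (s1 := [:: B]) Hm oD tri; rewrite big_seq1.
move=> BD _ BB; case: tri => /and3P[/andP[B1 /eqP cB] /andP[B'1 /eqP cB'] _] pw _ cols.
have BE : B.2 = class m c by apply: class_closed => //; rewrite -card_gt0 -cB.
have [b bB'] : exists b, b \in B'.2 by apply/set0Pn; rewrite -card_gt0 -cB'.
have : b \in (class_block m c).2 by rewrite -cols !big_cons !inE bB' orbT.
rewrite /= -BE; case/and3P: pw => /andP[/and3P[_ d _] _] _.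
by rewrite (disjointFl d bB').
Qed.

(** By induction on [C], placing last a class that no other column of [C]
    reaches: one whose elements reach as many columns as possible.  Removing it
    leaves a stable set. *)
Lemma stable_triangularization m C : matching m -> stable m C ->
  exists bs, [/\ block_triangularization G (m @: C, C) bs,
    forall B, B \in bs -> exists2 c, c \in C & B = class_block m c &
    forall c, c \in C -> class_block m c \in bs].
Proof.
move=> Hm; have [k] := ubnP #|C|; elim: k C => // k IH C kC sC.
have [->|[c0 c0C]] := set_0Vmem C.
  exists [::]; split=> //; last by move=> c; rewrite inE.
  by split=> //; rewrite big_nil ?imset0.
pose r c := #|[set c' | connect (depends m) c c']|.
have [c cC cmax] := arg_maxnP r c0C.
have [oC CC] := sC.
have KC : class m c \subset C.
  apply/subsetP => x; rewrite inE => /andP[cx _]; exact: connect_stable cx.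
have co : c != output G by apply: contraNneq oC => <-.
have src x : x \in C -> connect (depends m) x c -> x \in class m c.
  move=> xC xc; rewrite inE xc andbT; have := cmax x xC; rewrite /r => le.
  have sub : [set c' | connect (depends m) c c'] \subset
             [set c' | connect (depends m) x c'].
    by apply/subsetP => y; rewrite !inE; exact: connect_trans xc.
  have /eqP/setP/(_ x) : [set c' | connect (depends m) c c'] ==
             [set c' | connect (depends m) x c'] by rewrite eqEcard sub.
  by rewrite !inE connect0.
have sC' : stable m (C :\: class m c).
  split; first by rewrite inE negb_and oC orbT.
  move=> x y /setDP[xC xK] xy; rewrite inE (CC x) // andbT.
  apply: contra xK; rewrite inE => /andP[cy yc]; apply: src => //.
  exact: connect_trans (connect1 xy) yc.
have ltk : (#|C :\: class m c| < k)%N.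
  rewrite -ltnS; apply: leq_trans kC; rewrite ltnS; apply/proper_card/properP.
  split; first exact: subsetDl.
  by exists c => //; rewrite inE class_refl.
have [bs [[sq pw rows cols] bsC Cbs]] := IH _ ltk sC'.
simpl in rows, cols.
have CE : C = (C :\: class m c) :|: class m c.
  by rewrite setUC -[in LHS](setID C (class m c)) (setIidPr KC).
exists (rcons bs (class_block m c)); split.
- split=> /=.
  + rewrite all_rcons sq andbT /nonempty_square /= card_imset ?eqxx ?andbT;
      last exact: matching_inj.
    by apply/card_gt0P; exists c; exact: class_refl.
  + rewrite pairwise_rcons pw andbT; apply/allP => B /bsC[d dC ->] /=.
    have dK x : x \in class m d -> x \in C :\: class m c.
      rewrite inE => /andP[dx _]; exact: connect_stable sC' dC dx.
    have disj : [disjoint class m d & class m c].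
      by rewrite disjoint_subset; apply/subsetP => x /dK /setDP[].
    apply/and3P; split=> //=.
      rewrite disjoint_subset; apply/subsetP => _ /imsetP[x xd ->].
      by rewrite inE mem_matching_image // (disjointFr disj).
    apply/forall_inP => _ /imsetP[y yc ->]; apply/forall_inP => x xd.
    apply/negP => e; have := (sC'.2 x y (dK x xd)); rewrite inE yc /=.
    have [[xC _] yC] := (setDP (dK x xd), subsetP KC _ yc).
    suff -> : depends m x y by move/(_ isT).
    by apply/and3P; split=> //; apply: contraNneq oC => <-.
  + by rewrite -cats1 big_cat big_seq1 /= rows [in RHS]CE imsetU.
  + by rewrite -cats1 big_cat big_seq1 /= cols -CE.
- move=> B; rewrite mem_rcons inE => /orP[/eqP ->|/bsC[d /setDP[dC _] ->]].
    by exists c.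
  by exists d.
- move=> d dC; rewrite mem_rcons inE.
  have [dK|dK] := boolP (d \in class m c).
    by rewrite /class_block (class_eq dK) eqxx.
  by rewrite Cbs ?orbT // inE dK.
Qed.

Lemma stable_all m : stable m [set~ output G].
Proof. by split=> [|c c' _ /and3P[_ c'o _]]; rewrite !inE ?eqxx. Qed.

Lemma matching_rows m : matching m -> m @: [set~ output G] = [set~ input G].
Proof.
move=> Hm; apply/eqP; rewrite eqEcard card_imset; last exact: matching_inj.
rewrite !cardsC1 leqnn andbT; apply/subsetP => _ /imsetP[c + ->].
by rewrite !inE; exact: matching_input.
Qed.

Lemma class_homeostasis_block m c : matching m -> c != output G ->
  homeostasis_block G (class_block m c).
Proof.
move=> Hm co; have [bs [tri bsC Cbs]] := stable_triangularization Hm (stable_all m).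
exists bs; split.
- by move: tri; rewrite matching_rows.
- move=> B /bsC[d]; rewrite !inE => d_o ->; exact: irreducible_class.
- by apply: Cbs; rewrite !inE.
Qed.

(** The columns up to the block [B], and those strictly before it, form stable
    sets, so [B] is a union of classes.  If some column of [B] did not reach
    another one, the columns it reaches would split [B] into two blocks. *)
Lemma homeostasis_block_class m B : matching m -> homeostasis_block G B ->
  exists2 c, c != output G & B = class_block m c.
Proof.
move=> Hm [bs [tri irr Bbs]].
have {}irr := irr _ Bbs; case/splitPr: Bbs tri => s1 s2 tri.
have oD : output G \notin [set~ output G] by rewrite !inE eqxx.
rewrite /homeostasis_matrix -(matching_rows Hm) in tri.
have [_ m1 C1] := prefix_stable Hm oD tri.
move: (tri); rewrite -cat_rcons => tri'.
have [_ m2 C2] := prefix_stable Hm oD tri'.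
case: tri => sq pw _ cols; simpl in cols.
set P := \bigcup_(B <- s1) B.2 in m1 C1.
have E2 : \bigcup_(B <- rcons s1 B) B.2 = P :|: B.2 by rewrite -cats1 big_cat big_seq1.
have E1 : \bigcup_(B <- rcons s1 B) B.1 = m @: P :|: B.1.
  by rewrite -cats1 big_cat big_seq1 m1.
rewrite {}E2 {}E1 in m2 C2.
move: (sq); rewrite all_cat /= => /and3P[_ /andP[B1 /eqP cB] _].
move: (pw); rewrite pairwise_cat /= => /and4P[/allrelP pw12 pw1 pwB _].
have dis : [disjoint P & B.2].
  rewrite disjoint_subset; apply/subsetP => x; rewrite mem_bigcup_block.
  case/hasP=> B' B's xB'; have /and3P[_ d _] := pw12 _ _ B's (mem_head _ _).
  by rewrite inE (disjointFr d).
have mB : m @: B.2 = B.1.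
  apply/eqP; rewrite eqEcard card_imset; last exact: matching_inj.
  rewrite cB leqnn andbT; apply/subsetP => _ /imsetP[x xB ->].
  have : m x \in m @: (P :|: B.2) by rewrite imset_f // inE xB orbT.
  by rewrite m2 inE mem_matching_image // (disjointFl dis xB).
have BoD x : x \in B.2 -> x \in [set~ output G].
  by rewrite -cols big_cat big_cons !inE => ->; rewrite orbT.
have [c cB2] : exists c, c \in B.2 by apply/set0Pn; rewrite -card_gt0 -cB.
have co : c != output G by have := BoD _ cB2; rewrite !inE.
have oB : output G \notin B.2 by apply/negP => /BoD; rewrite !inE eqxx.
have oP : output G \notin P.
  apply/negP => oP; have : output G \in [set~ output G].
    by rewrite -cols big_cat inE oP.
  by rewrite !inE eqxx.
exists c => //; suff E : B.2 = class m c.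
  by rewrite /class_block -E mB -surjective_pairing.
have closed x : connect (depends m) c x -> x \in P :|: B.2.
  move=> cx; apply: (connect_stable _ _ cx); last by rewrite inE cB2 orbT.
  split; first by rewrite inE negb_or oP.
  move=> y y' yPB yy'; apply: (C2 y) => //; rewrite !inE.
  by case/and3P: yy'.
suff reach x y : x \in B.2 -> y \in B.2 -> connect (depends m) x y.
  apply/setP => x; apply/idP/idP => [xB|]; first by rewrite inE !reach.
  rewrite inE => /andP[/closed + xc]; rewrite inE => /orP[xP|//].
  suff : c \in P by rewrite (disjointFl dis cB2).
  apply: (connect_stable _ xP xc); split=> //.
  move=> y y' yPB yy'; apply: (C1 y) => //; rewrite !inE.
  by case/and3P: yy'.
move=> xB yB; apply: contraT => nxy.
pose X := [set z in B.2 | connect (depends m) x z].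
pose Y := B.2 :\: X.
have xX : x \in X by rewrite inE xB connect0.
have yY : y \in Y by rewrite !inE yB (negPf nxy).
have XY : [disjoint X & Y].
  rewrite disjoint_subset; apply/subsetP => z zX; rewrite !inE.
  by move: zX; rewrite inE => ->.
have XYB : X :|: Y = B.2.
  have XB : X \subset B.2 by apply/subsetP => z; rewrite inE => /andP[].
  by rewrite -[RHS](setID B.2 X) (setIidPr XB).
suff /irr : block_triangularization G B [:: (m @: X, X); (m @: Y, Y)] by [].
split=> /=.
- rewrite /nonempty_square /= !card_imset; try exact: matching_inj.
  by rewrite !eqxx !andbT; apply/andP; split; apply/card_gt0P; [exists x|exists y].
- rewrite !andbT /upper_triangular /= XY /=; apply/andP; split.
    rewrite disjoint_subset; apply/subsetP => _ /imsetP[z zX ->].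
    by rewrite inE mem_matching_image // (disjointFr XY).
  apply/forall_inP => _ /imsetP[z zY ->]; apply/forall_inP => t tX.
  apply/negP => e; move: tX zY; rewrite !inE => /andP[tB xt] /andP[+ zB].
  rewrite zB /= => /negP; apply; apply: connect_trans xt (connect1 _).
  apply/and3P; split=> //.
    by have := BoD _ tB; rewrite !inE.
  by have := BoD _ zB; rewrite !inE.
- by rewrite !big_cons big_nil /= setU0 -imsetU XYB.
- by rewrite !big_cons big_nil /= setU0 XYB.
Qed.

End Matchings.

(** * io-simple paths and matchings *)

Section Paths.
Variables (n : nat) (G : network n).
Implicit Types (m : 'I_n -> 'I_n) (p : seq 'I_n) (c u v w r : 'I_n).

Lemma io_simple_path_of_walk p : path (arrow G) (input G) p ->
  last (input G) p = output G ->
  exists2 p', io_simple_path G p' & {subset p' <= input G :: p}.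
Proof.
case/shortenP=> p' pp' up' sub lp'; exists (input G :: p'); first by exists p'.
by move=> x; rewrite !inE => /orP[->//|/sub ->]; rewrite orbT.
Qed.

Lemma io_simple_path_input p : io_simple_path G p -> input G \in p.
Proof. by case=> p' [-> _ _ _]; exact: mem_head. Qed.

Lemma io_simple_path_output p : io_simple_path G p -> output G \in p.
Proof. by case=> p' [-> _ <- _]; exact: mem_last. Qed.

Lemma index_input p : io_simple_path G p -> index (input G) p = 0%N.
Proof. by case=> p' [-> _ _ _] /=; rewrite eqxx. Qed.

Lemma index_output p v : io_simple_path G p -> v \in p ->
  (index v p <= index (output G) p)%N.
Proof.
case=> p' [-> _ <- up] vp; rewrite index_last // -ltnS.
by move: vp; rewrite -index_mem.
Qed.

Lemma io_simple_path_uniq p : io_simple_path G p -> uniq p.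
Proof. by case=> p' []. Qed.

Lemma next_output p : io_simple_path G p -> next p (output G) = input G.
Proof.
case=> p' [-> _ <- up]; rewrite next_nth mem_last index_last //.
by rewrite nth_default.
Qed.

Lemma index_lt_output p v : io_simple_path G p -> v \in p -> v != output G ->
  (index v p < index (output G) p)%N.
Proof.
move=> ip vp vo; rewrite ltn_neqAle index_output // andbT.
apply: contra vo => /eqP/(index_inj v vp) -> //.
exact: io_simple_path_output.
Qed.

Lemma index_next p v : io_simple_path G p -> v \in p -> v != output G ->
  index (next p v) p = (index v p).+1.
Proof.
move=> ip vp vo; have lt := index_lt_output ip vp vo.
case: ip vp vo lt => p' [-> _ <- up] vp vo; rewrite index_last // => lt.
rewrite next_nth vp.
rewrite -[nth _ _ _]/(nth (input G) (input G :: p') (index v (input G :: p')).+1).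
by rewrite index_uniq.
Qed.

Lemma arrow_next p v : io_simple_path G p -> v \in p -> v != output G ->
  arrow G v (next p v).
Proof.
move=> ip vp vo; have lt := index_lt_output ip vp vo.
case: ip vp vo lt => p' [-> pp <- up] vp vo; rewrite index_last // => lt.
rewrite next_nth vp; have /(pathP (input G))/(_ _ lt) := pp.
by rewrite nth_index.
Qed.

Lemma next_notin p v : v \notin p -> next p v = v.
Proof. by rewrite next_nth => /negPf ->. Qed.

Lemma next_matching p : io_simple_path G p -> matching G (next p).
Proof.
move=> ip; split; first exact: can_inj (prev_next (io_simple_path_uniq ip)).
  exact: next_output.
move=> c co; have [cp|cp] := boolP (c \in p).
  by rewrite /nonzero_entry arrow_next // orbT.
by rewrite next_notin // /nonzero_entry eqxx.
Qed.

(** The nodes that can be reached from the input without visiting [r]; none if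
    [r] is the input itself. *)
Definition avoiding r : {set 'I_n} :=
  [set v | (input G != r) &&
           connect (fun x y => arrow G x y && (y != r)) (input G) v].

Lemma avoiding_step r v w : v \in avoiding r -> arrow G v w ->
  (w \in avoiding r) = (w != r).
Proof.
rewrite !inE => /andP[ir cv] vw; rewrite ir /=; apply/idP/idP => [cw|wr].
  apply: contraTneq cw => ->; apply/connectP => -[p pp lp].
  case/lastP: p pp lp => [|p x] /=; first by move=> _ ri; rewrite ri eqxx in ir.
  by rewrite rcons_path last_rcons => /andP[_ /andP[_ /negP H]] /esym/eqP.
by apply: connect_trans cv (connect1 _); rewrite vw.
Qed.

Lemma avoiding_self r : r \notin avoiding r.
Proof.
rewrite inE; apply/andP => -[ir /connectP[p]].
case/lastP: p => [|p x] /=; first by move=> _ ri; rewrite ri eqxx in ir.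
by rewrite rcons_path last_rcons => /andP[_ /andP[_ /negP H]] /esym/eqP.
Qed.

Lemma io_simple_path_split p v : io_simple_path G p -> v \in p ->
  exists p1 p2,
    [/\ path (arrow G) (input G) p1, last (input G) p1 = v,
        path (arrow G) v p2 & last v p2 = output G] /\
    [/\ p = (input G :: p1) ++ p2,
        {in input G :: p1, forall x, index x p <= index v p}%N &
        {in p2, forall x, index v p < index x p}%N].
Proof.
case=> p' [-> pp lp up] vp; case/splitPl: vp pp lp up => p1 p2 vE.
rewrite cat_path last_cat vE -cat_cons; case/andP=> pp1 pp2 lp up; exists p1, p2; split=> //.
have iv : index v ((input G :: p1) ++ p2) = size p1.
  rewrite index_cat -vE mem_last index_last //.
  by move: up; rewrite cat_uniq => /and3P[].
rewrite iv; split=> // x xp; first by rewrite index_cat xp -ltnS; rewrite -index_mem in xp.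
rewrite index_cat; case: ifP => [x1|_]; last by rewrite /= addSn ltnS leq_addr.
by move: up; rewrite cat_uniq => /and3P[_ /hasPn/(_ _ xp)]; rewrite x1.
Qed.

(** A node that comes after [r] on [p] and is reached without visiting [r] would
    give, by continuing along [p], a walk to the output that avoids [r]. *)
Lemma avoiding_index p r v : super_simple_node G r -> io_simple_path G p ->
  v \in p -> (v \in avoiding r) = (index v p < index r p)%N.
Proof.
move=> sr ip vp; have rp := sr _ ip.
have [p1 [p2 [[pp1 lp1 pp2 lp2] [pE le1 lt2]]]] := io_simple_path_split ip vp.
apply/idP/idP => [|lt].
  move=> va; rewrite ltnNge; apply/negP => le.
  have vr : v != r by apply: contraTneq va => ->; exact: avoiding_self.
  move: va; rewrite inE => /andP[ir /connectP[s ps vE]].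
  have ps' : path (arrow G) (input G) s by apply: sub_path ps => x y /andP[].
  have rs : r \notin input G :: s.
    rewrite inE negb_or eq_sym ir /=.
    elim: s (input G) ps {vE ps'} => //= x s IH y /andP[/andP[_ xr] /IH].
    by rewrite inE negb_or eq_sym xr.
  have rt : r \notin p2 by apply/negP => /lt2; rewrite ltnNge le.
  have := @io_simple_path_of_walk (s ++ p2).
  rewrite cat_path ps' last_cat -vE pp2 lp2 => /(_ isT erefl)[p3 ip3 sub].
  by have := sub _ (sr _ ip3); rewrite -cat_cons mem_cat (negPf rs) (negPf rt).
have r1 : r \notin input G :: p1 by apply/negP => /le1; rewrite leqNgt lt.
move: r1; rewrite !inE negb_or eq_sym => /andP[-> r1] /=.
apply/connectP; exists p1 => //; elim: p1 (input G) pp1 r1 {lp1 pE le1} => //= x s IH y.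
by case/andP=> -> /IH{}IH; rewrite inE negb_or eq_sym => /andP[-> /IH].
Qed.

(** The arrows that leave [avoiding r] all end in [r], so the matching sends
    [avoiding r] onto itself with [r] added and the input removed. *)
Lemma avoiding_stable m r : matching G m -> super_simple_node G r ->
  core G -> stable G m (avoiding r).
Proof.
move=> Hm sr cG.
have [p ip] : exists p, io_simple_path G p.
  have [_ /connectP[s ps ls]] := cG (input G).
  by have [p ip _] := io_simple_path_of_walk ps (esym ls); exists p.
have oA : output G \notin avoiding r.
  by rewrite (avoiding_index sr ip) ?io_simple_path_output // -leqNgt index_output // sr.
split=> // c c' cA /and3P[co c'o].
have iA : input G \in avoiding r.
  by move: cA; rewrite !inE connect0 andbT => /andP[].
have mA : m @: avoiding r = (r |: avoiding r) :\ input G.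
  apply/eqP; rewrite eqEcard card_imset; last exact: matching_inj Hm.
  have := cardsD1 (input G) (r |: avoiding r).
  rewrite cardsU1 avoiding_self in_setU iA orbT => /eqP.
  rewrite eqn_add2l => /eqP <-; rewrite leqnn andbT; apply/subsetP => _ /imsetP[d dA ->].
  have d_o : d != output G by apply: contraNneq oA => <-.
  rewrite in_setD1 in_setU1 (matching_input Hm d_o) /=.
  have [//|mdr /=] := eqVneq (m d) r.
  have /orP[/eqP->|e] := matching_entry Hm d_o; first by [].
  by rewrite (avoiding_step dA e).
move=> e; suff : m c' \in m @: avoiding r by rewrite (mem_matching_image _ _ Hm).
rewrite mA in_setD1 in_setU1 (matching_input Hm c'o) /=.
have [//|mdr /=] := eqVneq (m c') r.
case/orP: e => [/eqP->|e]; first by [].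
by rewrite (avoiding_step cA e).
Qed.

(** Composing [m] with the rotation of a simple cycle of dependences through [c]
    and [c'] gives another matching. *)
Lemma matching_rotate m c c' : matching G m -> depends G m c c' ->
  connect (depends G m) c' c -> exists2 m', matching G m' & m' c = m c'.
Proof.
move=> Hm cc' /connectP[p0 pp0 lp0]; case: (shortenP pp0) lp0 => p pp up _ lp.
pose s := c' :: p; have cyc : cycle (depends G m) s by rewrite /= rcons_path pp -lp.
have nc : next s c = c'.
  have cs : c \in s by rewrite lp mem_last.
  have ic : index c s = size p by rewrite lp index_last.
  by rewrite next_nth cs ic /s /= nth_default.
exists (m \o next s); last by rewrite /comp nc.
have os : output G \notin s.
  apply/negP => /(next_cycle cyc)/and3P[]; by rewrite eqxx.
split.
- exact: inj_comp (matching_inj Hm) (can_inj (prev_next up)).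
- by rewrite /comp next_notin // (matching_output Hm).
- move=> d d_o; rewrite /comp; have [ds|ds] := boolP (d \in s).
    by have /and3P[] := next_cycle cyc ds.
  by rewrite next_notin //; exact: matching_entry.
Qed.


(** The orbit of the input closes up at the output, the only node that [m] sends
    to the input. *)
Lemma matching_io_path m : matching G m ->
  io_simple_path G (orbit m (input G)).
Proof.
move=> Hm; have mi := matching_inj Hm.
have up := orbit_uniq m (input G); have cyc := cycle_orbit mi (input G).
case oE : (orbit m (input G)) => [|x p].
  by have := in_orbit m (input G); rewrite oE.
have xE : x = input G by have := oE; rewrite /orbit -orderSpred => -[].
subst x; rewrite oE /= in up cyc *.
move: cyc; rewrite rcons_path => /andP[pp /eqP lp].
have {}lp : last (input G) p = output G.
  by apply: mi; rewrite lp matching_output.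
exists p; split=> //; elim: p (input G) up pp lp {oE} => //= y p IH x.
rewrite inE negb_or => /andP[/andP[xy xp] up] /andP[/eqP mx pp] lp.
rewrite IH // andbT; have xo : x != output G.
  by apply: contraNneq xp => xo; have := mem_last y p; rewrite lp -xo inE (negPf xy).
by have := matching_entry Hm xo; rewrite mx /nonzero_entry eq_sym (negPf xy).
Qed.

Lemma connect_off_orbit m v w : matching G m -> v \notin orbit m (input G) ->
  fconnect m v w -> connect (complement_arrow G (orbit m (input G))) v w.
Proof.
move=> Hm + /connectP[s + ->]; elim: s v => [|x s IH] v /= vp; first by [].
case/andP=> /eqP <- sx.
have mvp : m v \notin orbit m (input G).
  apply: contra vp; rewrite -!fconnect_orbit => H.
  rewrite fconnect_sym; last exact: matching_inj Hm.
  apply: (connect_trans (fconnect1 m v)).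
  by rewrite fconnect_sym //; exact: matching_inj Hm.
apply: connect_trans (IH _ mvp sx).
have vo : v != output G.
  apply: contraNneq vp => ->; apply: io_simple_path_output.
  exact: matching_io_path.
have /orP[/eqP ->|e] := matching_entry Hm vo; first exact: connect0.
by apply: connect1; apply/and3P.
Qed.

(** A component made of appendage nodes meets no io-simple path, so it stays
    connected in every complementary subnetwork. *)
Lemma component_transfer p p' v w : io_simple_path G p' ->
  (forall x, transitive_component G p v x -> appendage_node G x) ->
  transitive_component G p v w -> transitive_component G p' v w.
Proof.
move=> ip' app; have off x : transitive_component G p v x -> x \notin p'.
  by move=> /app ax; apply/negP => xp'; apply: ax; exists p'.
have half x y : connect (complement_arrow G p) v x ->
    connect (complement_arrow G p) y v ->
    connect (complement_arrow G p) x y -> connect (complement_arrow G p') x y.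
  move=> + + /connectP[s]; elim: s x => [|z s IH] x /= vx yv.
    by move=> _ ->.
  case/andP=> xz sz yE; have vz := connect_trans vx (connect1 xz).
  have zy : connect (complement_arrow G p) z y by apply/connectP; exists s.
  apply: connect_trans (IH z vz yv sz yE); apply/connect1/and3P; split.
  - by case/and3P: xz.
  - apply: off; split=> //; apply: connect_trans (connect1 xz) _.
    exact: connect_trans zy yv.
  - apply: off; split=> //; exact: connect_trans zy yv.
by case=> vw wv; split; apply: half.
Qed.

Lemma component_depends p v w : io_simple_path G p ->
  v \notin p -> connect (complement_arrow G p) v w ->
  connect (depends G (next p)) v w.
Proof.
move=> ip vp; apply: connect_sub => x y /and3P[xy xp yp].
have out z : z \notin p -> z != output G.
  by apply: contraNneq => ->; exact: io_simple_path_output.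
by apply/connect1/and3P; rewrite !out // next_notin // /nonzero_entry xy orbT.
Qed.

Lemma component_notin p v w : v \notin p ->
  connect (complement_arrow G p) v w -> w \notin p.
Proof.
move=> + /connectP[s + ->]; elim: s v => [|x s IH] v vp //= /andP[/and3P[_ _ xp]].
exact: IH.
Qed.

Lemma appendage_notin p v : appendage_node G v -> io_simple_path G p -> v \notin p.
Proof. by move=> av ip; apply/negP => vp; apply: av; exists p. Qed.

Lemma leaving_edge m (C : {set 'I_n}) v w : connect (depends G m) v w ->
  v \in C -> w \notin C ->
  exists c c', [/\ c \in C, c' \notin C, depends G m c c',
    connect (depends G m) v c & connect (depends G m) c' w].
Proof.
case/connectP=> s + ->; elim: s v => [|x s IH] v /=; first by move=> _ ->.
case/andP=> vx sx vC lC; have [xC|xC] := boolP (x \in C); last first.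
  exists v, x; split=> //.
  by apply/connectP; exists s.
have [c [c' [cC c'C cc' xc c'w]]] := IH x sx xC lC.
exists c, c'; split=> //; exact: connect_trans (connect1 vx) xc.
Qed.

(** Suppose that [v] lies in the class of a simple node.  The transitive
    component [C] of [v] consists of appendage nodes and is the same off every
    io-simple path.  Some dependence [k -> c'] leaves [C] and returns to [k], so
    a matching [m'] can be chosen that follows the corresponding arrow from [k]
    to a node [u] outside [C].  As [k] is not on the io-simple path of [m'], it
    is on a cycle of [m'] off this path, and so is [u]: then [u] would belong to
    [C]. *)
Lemma super_appendage_class m v c : matching G m -> core G ->
  super_appendage_node G v -> c != output G -> simple_node G c ->
  v \notin class G m c.
Proof.
move=> Hm cG [av sav] co sc.
have [p ip cp] := sc; rewrite (class_matching c Hm (next_matching ip)).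
have vp := appendage_notin av ip.
apply/negP; rewrite inE => /andP[cv vc].
pose C := [set w | connect (complement_arrow G p) v w && connect (complement_arrow G p) w v].
have CP w : w \in C -> transitive_component G p v w by rewrite inE => /andP[].
have Capp w : w \in C -> appendage_node G w by move/CP/(sav p ip vp).
have vC : v \in C by rewrite inE connect0.
have cC : c \notin C by apply/negP => /Capp.
have [k [c' [kC c'C kc' vk c'c]]] := leaving_edge vc vC cC.
have ak := Capp _ kC; have kp := appendage_notin ak ip.
have c'k : connect (depends G (next p)) c' k.
  exact: connect_trans c'c (connect_trans cv vk).
have uk : next p c' != k.
  apply: contraNneq c'C => E.
  suff -> : c' = k by [].
  by apply: (matching_inj (next_matching ip)); rewrite E next_notin.
have [m' Hm' m'k] := matching_rotate (next_matching ip) kc' c'k.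
set u := next p c' in uk m'k.
have uC : u \notin C.
  have [c'p|c'p] := boolP (c' \in p).
    by apply/negP => /Capp; apply; exists p => //; rewrite /u mem_next.
  by rewrite /u next_notin.
have ip' := matching_io_path Hm'; set p' := orbit m' (input G) in ip'.
have kp' := appendage_notin ak ip'; have vp' := appendage_notin av ip'.
have ku : transitive_component G p' k u.
  split; first by apply: connect_off_orbit => //; rewrite -m'k; exact: fconnect1.
  apply: connect_off_orbit => //.
    apply: contra kp'; rewrite -!fconnect_orbit => H.
    rewrite fconnect_sym; last exact: matching_inj Hm'.
    apply: (connect_trans (fconnect1 m' k)).
    by rewrite m'k fconnect_sym //; exact: matching_inj Hm'.
  rewrite fconnect_sym; last exact: matching_inj Hm'.
  by rewrite -m'k; exact: fconnect1.
have [vk' kv'] := component_transfer ip' (sav p ip vp) (CP _ kC).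
have vu : transitive_component G p' v u.
  by case: ku => ku uk'; split; [exact: connect_trans vk' ku|exact: connect_trans uk' kv'].
have [vu' uv'] := component_transfer ip (sav p' ip' vp') vu.
by rewrite inE vu' uv' in uC.
Qed.
End Paths.

(** * The class of a super-simple node *)

Section Structural.
Variables (n : nat) (G : network n) (q : nat) (rho : 'I_q.+2 -> 'I_n).
Hypotheses (hcore : core G) (hrho : super_simple_order G rho).
Implicit Types (m : 'I_n -> 'I_n) (p : seq 'I_n) (c u v w : 'I_n) (k l : 'I_q.+2) (j : 'I_q.+1).

Lemma core_io_simple_path : exists p, io_simple_path G p.
Proof.
have [_ /connectP[s ps ls]] := hcore (input G).
by have [p ip _] := io_simple_path_of_walk ps (esym ls); exists p.
Qed.

Lemma super_simple_rho k : super_simple_node G (rho k).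
Proof. by apply/(hrho.1); exists k. Qed.

Lemma rho_avoiding k l : (rho k \in avoiding G (rho l)) = (k < l)%N.
Proof.
have lt k' l' : (k' < l')%N -> rho k' \in avoiding G (rho l').
  move=> /(hrho.2)[p [r [[ip kp lp _] [_ _ lt]]]].
  by rewrite (avoiding_index (super_simple_rho _) ip).
have [kl|lk|kl] := ltngtP k l; first exact: lt.
  have [p ip] := core_io_simple_path.
  have := lt _ _ lk; rewrite !(avoiding_index (super_simple_rho _) ip) ?super_simple_rho //.
  by move=> lt'; rewrite ltnNge ltnW.
by rewrite (val_inj kl : k = l) (negPf (avoiding_self _ _)).
Qed.

Lemma rho_index p k l : io_simple_path G p ->
  (index (rho k) p < index (rho l) p)%N = (k < l)%N.
Proof.
by move=> ip; rewrite -rho_avoiding (avoiding_index (super_simple_rho _) ip) ?super_simple_rho.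
Qed.

Lemma index_rho_pred_succ p j : io_simple_path G p ->
  (index (rho_pred rho j) p < index (rho_succ rho j) p)%N.
Proof. by move=> ip; rewrite rho_index //= /bump /=. Qed.

Lemma rho_pred_output j : rho_pred rho j != output G.
Proof.
have [p ip] := core_io_simple_path.
apply/eqP => jo; have := index_rho_pred_succ j ip.
by rewrite jo ltnNge index_output // super_simple_rho.
Qed.

Lemma between_not_super_simple p j v : io_simple_path G p ->
  (index (rho_pred rho j) p < index v p < index (rho_succ rho j) p)%N ->
  ~ super_simple_node G v.
Proof.
move=> ip /andP[lt1 lt2] /(hrho.1)[k vE]; move: lt1 lt2; rewrite vE !rho_index //=.
by rewrite /bump /= add1n ltnS => lt1; rewrite leqNgt lt1.
Qed.

(** Let [u] follow [v] on [p].  The row [u] is matched with the column [v] by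
    [next p], and with the column [u] by [next p'] for a path [p'] that avoids
    [u].  The image of a stable set does not depend on the matching, so a stable
    set that contains [v] contains [u]. *)
Lemma next_class p v : io_simple_path G p -> v \in p -> v != output G ->
  ~ super_simple_node G (next p v) -> class G (next p) (next p v) = class G (next p) v.
Proof.
move=> ip vp vo nss; have Hm := next_matching ip; apply: class_eq.
have uo : next p v != output G.
  by apply: contra_notN nss => /eqP -> p' ip'; exact: io_simple_path_output.
rewrite inE andbC connect1 /=; last by rewrite /depends uo vo /nonzero_entry eqxx.
have [p' [ip' up']] : exists p', io_simple_path G p' /\ next p v \notin p'.
  apply: contrapT => H; apply: nss => p' ip'; apply: contraT => up'; case: H.
  by exists p'.
have Hm' := next_matching ip'.
have sC := stable_reach (next p) vo.
have := mem_matching_image [set c' | connect (depends G (next p)) v c'] v Hm.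
rewrite -(stable_image Hm Hm' sC) [in RHS]inE connect0 => im.
rewrite -[X in X \in _](next_notin up') (mem_matching_image _ _ Hm') in im.
by rewrite inE in im.
Qed.

Lemma segment_class p j v : io_simple_path G p -> v \in p ->
  (index (rho_pred rho j) p <= index v p < index (rho_succ rho j) p)%N ->
  v \in class G (next p) (rho_pred rho j).
Proof.
move=> ip; set a := rho_pred rho j; have ap : a \in p by exact: super_simple_rho.
have [d dE] : exists d, d = (index v p - index a p)%N by eexists.
elim: d v dE => [|d IH] v dE vp /andP[le lt].
  have /(index_inj a vp ap) -> : index v p = index a p by lia.
  exact: class_refl.
have [p' [pE _ _ _]] := ip.
pose u := nth (input G) p (index v p).-1.
have sz : (index v p < size p)%N by rewrite index_mem.
have szu : ((index v p).-1 < size p)%N := leq_ltn_trans (leq_pred _) sz.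
have iu : index u p = (index v p).-1.
  by rewrite index_uniq ?(io_simple_path_uniq ip).
have up : u \in p by rewrite mem_nth.
have uo : u != output G.
  by apply: contraTneq (index_output ip vp) => uo; rewrite -uo iu; lia.
have vE : v = next p u.
  apply: (index_inj u vp); first by rewrite mem_next.
  by rewrite (index_next ip up uo) iu; lia.
have nss : ~ super_simple_node G (next p u).
  by rewrite -vE; apply: (between_not_super_simple (p := p) (j := j)) => //; rewrite -/a; lia.
have uC : u \in class G (next p) a by apply: IH => //; lia.
by rewrite -(class_eq uC) -(next_class ip up uo nss) vE class_refl.
Qed.

Section Class.
Variables (m : 'I_n -> 'I_n) (j : 'I_q.+1).
Hypothesis Hm : matching G m.
Local Notation a := (rho_pred rho j).
Local Notation d := (rho_succ rho j).
Local Notation K := (class G m a).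

Lemma class_avoiding v : v \in K -> v \in avoiding G d /\ v \notin avoiding G a.
Proof.
rewrite inE => /andP[av va]; split.
  apply: (connect_stable (avoiding_stable Hm (super_simple_rho _) hcore) _ av).
  by rewrite rho_avoiding /= /bump.
apply/negP => vA; have := connect_stable (avoiding_stable Hm (super_simple_rho _) hcore) vA va.
by rewrite rho_avoiding ltnn.
Qed.

Lemma class_index p v : io_simple_path G p -> v \in p ->
  (v \in K) = (index a p <= index v p < index d p)%N.
Proof.
move=> ip vp; apply/idP/idP => [/class_avoiding|].
  by rewrite !(avoiding_index (super_simple_rho _) ip) // -leqNgt => -[-> ->].
by rewrite (class_matching _ Hm (next_matching ip)); exact: segment_class.
Qed.

Lemma class_image_index p v : io_simple_path G p -> v \in p ->
  (v \in m @: K) = (index a p < index v p <= index d p)%N.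
Proof.
move=> ip vp; have Hp := next_matching ip.
rewrite (class_image Hm Hp (rho_pred_output j)).
have [g _ gK] := injF_bij (matching_inj Hp); rewrite -(gK v).
have up : g v \in p by rewrite -mem_next gK.
rewrite (mem_matching_image _ _ Hp) -(class_matching _ Hm Hp) (class_index ip up).
have [uo|uo] := eqVneq (g v) (output G); last by rewrite (index_next ip up uo).
rewrite uo (next_output ip) (index_input ip) ltn0 /=.
by apply/negbTE; rewrite negb_and orbC -leqNgt index_output // super_simple_rho.
Qed.

Lemma class_off_path p v : io_simple_path G p -> v \notin p ->
  (v \in m @: K) = (v \in K).
Proof.
move=> ip vp; have Hp := next_matching ip.
rewrite (class_image Hm Hp (rho_pred_output j)) -{1}(next_notin vp).
by rewrite (mem_matching_image _ _ Hp) -(class_matching _ Hm Hp).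
Qed.

(** The rows and the columns of the block agree except at the two ends: off a
    path they are matched identically, along it they are shifted by one. *)
Lemma class_rows v : (v \in m @: K) = (v == d) || (v \in K) && (v != a).
Proof.
have [p ip] := core_io_simple_path; have lt := index_rho_pred_succ j ip.
have dp : d \in p by exact: super_simple_rho.
have ap : a \in p by exact: super_simple_rho.
have [vp|vp] := boolP (v \in p); last first.
  rewrite (class_off_path ip vp); have -> : v == d = false by apply: contraNF vp => /eqP ->.
  by have -> : v != a by [apply: contraNneq vp => ->]; rewrite andbT.
rewrite (class_image_index ip vp) (class_index ip vp).
have iE w : w \in p -> (v == w) = (index v p == index w p).
  by move=> wp; apply/eqP/eqP => [->//|/(index_inj a vp wp)].
by rewrite !iE //; lia.
Qed.

(** The bounds on [v] may come from two different paths; [avoiding_index]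
    transports them to a single one. *)
Lemma simple_subnetwork_class v : simple_subnetwork G rho j v <->
  simple_node G v /\ v \in K /\ v != a.
Proof.
split=> [[sv [p [r [[ip ap vp _] [_ _ lt]]]] [p' [r' [[ip' vp' dp' _] [_ _ lt']]]]]|].
  split=> //; rewrite (class_index ip vp) (ltnW lt).
  rewrite -(avoiding_index (super_simple_rho _) ip) //.
  rewrite (avoiding_index (super_simple_rho _) ip') // lt'; split=> //.
  by apply: contraTneq lt => ->; rewrite ltnn.
case=> sv [vK va]; have [p ip vp] := sv.
have ap : a \in p by exact: super_simple_rho.
have dp : d \in p by exact: super_simple_rho.
move: vK; rewrite (class_index ip vp) => /andP[le lt].
have lt' : (index a p < index v p)%N.
  rewrite ltn_neqAle le andbT; apply: contra va => /eqP/(index_inj a ap vp) ->.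
  by rewrite eqxx.
split=> //.
- exists p, a; split; first by split=> //; exact: super_simple_rho.
  by split=> //; exact: ltnW.
- exists p, d; split; first by split=> //; exact: super_simple_rho.
  by split=> //; exact: ltnW.
Qed.

Lemma component_class p v w : io_simple_path G p -> v \notin p ->
  transitive_component G p v w -> v \in K -> w \in K.
Proof.
move=> ip vp [vw wv] vK; have Hp := next_matching ip.
rewrite (class_matching _ Hm Hp) in vK *; rewrite -(class_eq vK) inE.
have wp := component_notin vp vw.
by rewrite !(component_depends ip).
Qed.

(** An appendage node of the class is not super-appendage, so its component off
    some path contains a simple node.  That component stays inside the class,
    whose simple nodes are known. *)
Lemma augmented_simple_subnetwork_class v :
  augmented_simple_subnetwork G rho j v <-> v \in K /\ v != a.
Proof.
have simple_rho k : simple_node G (rho k).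
  have [p ip] := core_io_simple_path; exists p => //; exact: super_simple_rho.
split=> [[/simple_subnetwork_class[_]//|]|[vK va]].
  move=> [[av _] [p [ip vp [w vw /simple_subnetwork_class[_ [wK _]]] _]]].
  have [vw' wv'] := vw; split; last by apply: contra_notN av => /eqP ->; exact: simple_rho.
  apply: (@component_class p w v) => //; exact: component_notin vw'.
have app_non_super w : w \in K -> appendage_node G w -> non_super_appendage_node G w.
  move=> wK aw; split=> // sw.
  have := super_appendage_class Hm hcore sw (rho_pred_output j) (simple_rho _).
  by rewrite wK.
have [sv|av] := pselect (simple_node G v).
  by left; apply/simple_subnetwork_class.
right; split; first exact: app_non_super.
have [_ nsv] := app_non_super v vK av.
have [p [ip vp [w vw sw]]] : exists p, [/\ io_simple_path G p, v \notin p &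
    exists2 w, transitive_component G p v w & simple_node G w].
  apply: contrapT => H; apply: nsv; split=> // p ip vp w vw sw; apply: H.
  by exists p; split=> //; exists w.
have simple_in w' : transitive_component G p v w' -> simple_node G w' ->
    simple_subnetwork G rho j w'.
  move=> vw' sw'; apply/simple_subnetwork_class; split=> //.
  split; first exact: component_class vw' vK.
  apply: contraTneq (component_notin vp vw'.1) => ->.
  by rewrite negbK; exact: super_simple_rho.
exists p; split=> //; first by exists w => //; exact: simple_in.
move=> w' vw'; have [sw'|aw'] := pselect (simple_node G w').
  by apply: Or32; exact: simple_in.
by apply: Or33; apply: app_non_super => //; exact: component_class vw' vK.
Qed.

Lemma structural_subnetwork_class v : structural_subnetwork G rho j v <->
  v \in K \/ v \in m @: K.
Proof.
rewrite class_rows; split=> [[->|/augmented_simple_subnetwork_class[-> _]|->]|].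
- by left; exact: class_refl.
- by left.
- by right; rewrite eqxx.
have [->|va] := eqVneq v a; first by move=> _; apply: Or31.
case=> [vK|/orP[/eqP->|/andP[vK _]]].
- by apply: Or32; apply/augmented_simple_subnetwork_class.
- by apply: Or33.
- by apply: Or32; apply/augmented_simple_subnetwork_class.
Qed.

Lemma rho_succ_class : d \notin K.
Proof. by apply/negP => /class_avoiding[]; rewrite (negPf (avoiding_self _ _)). Qed.

End Class.

Lemma block_nodes_class m c v : matching G m -> c != output G ->
  block_nodes G (class_block G m c) v <-> v \in class G m c \/ v \in m @: class G m c.
Proof.
move=> Hm co; split=> [[w [[]|[]]]|[vK|/imsetP[w wK ->]]].
- by right.
- by left.
- exists (m v); right; split=> //; first exact: imset_f.
  apply: matching_entry => //; apply: contraNneq (class_output m co) => <-.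
  exact: vK.
- exists w; left; split=> //; first exact: imset_f.
  by apply: matching_entry => //; apply: contraNneq (class_output m co) => <-.
Qed.

(** Another class with the same nodes would be disjoint from that of [rho_j] in
    columns, hence reduced to the column [rho_(j+1)] matched with the row
    [rho_j]; but matchings along paths go forward. *)
Lemma structural_block m j B : matching G m -> homeostasis_block G B ->
  (forall v, block_nodes G B v <-> structural_subnetwork G rho j v) ->
  B = class_block G m (rho_pred rho j).
Proof.
move=> Hm /(homeostasis_block_class Hm)[c co ->] nodes.
set a := rho_pred rho j; set d := rho_succ rho j.
have E v : (v \in class G m c) || (v \in m @: class G m c) =
           (v == d) || (v \in class G m a).
  have -> : (v == d) || (v \in class G m a) =
      (v \in class G m a) || (v \in m @: class G m a).
    by rewrite class_rows // orbCA; case: (v \in class G m a).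
  have := nodes v; rewrite block_nodes_class // (structural_subnetwork_class _ Hm) => H.
  by apply/orP/orP; apply H.
have [ca|nca] := boolP (c \in class G m a).
  by rewrite /class_block (class_eq ca).
exfalso; have disj v : v \in class G m c -> v \notin class G m a.
  by move=> vc; apply: contra nca => va; rewrite -(class_eq va) (class_eq vc) class_refl.
have Kd v : v \in class G m c -> v = d.
  by move=> vc; have := E v; rewrite vc (negPf (disj _ vc)) orbF => /esym/eqP.
have cd := Kd c (class_refl G m c).
have [p ip] := core_io_simple_path; have Hp := next_matching ip.
have ad : a != d.
  by apply: contraTneq (index_rho_pred_succ j ip); rewrite -/a -/d => ->; rewrite ltnn.
have /orP[/Kd/eqP|] : (a \in class G m c) || (a \in m @: class G m c).
- by rewrite E class_refl orbT.
- by rewrite (negPf ad).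
rewrite (class_image Hm Hp co) -(class_matching _ Hm Hp) => /imsetP[v /Kd -> aE].
rewrite cd in co; have := index_next ip (super_simple_rho _ ip) co; rewrite -aE => iE.
by have := index_rho_pred_succ j ip; rewrite -/a -/d iE ltnNge leqnSn.
Qed.
End Structural.

Local Open Scope ring_scope.

(** * Singular blocks *)

Section Kernels.
Variables (R : realType) (n : nat).
Implicit Types (J : 'M[R]_n) (y : 'cV[R]_n) (A U : {set 'I_n}).

(** Vectors indexed by part of the nodes, extended by zero. *)
Lemma spread_vector N (g : 'I_N -> 'I_n) (v : 'rV[R]_N) : injective g ->
  exists y, [/\ forall k, y (g k) 0 = v 0 k,
    forall c, c \notin codom g -> y c 0 = 0 &
    forall J u, (J *m y) u 0 = \sum_k J u (g k) * v 0 k].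
Proof.
move=> gi; pose y : 'cV[R]_n := \sum_k v 0 k *: delta_mx (g k) 0.
have yE c : y c 0 = \sum_k v 0 k * (c == g k)%:R.
  by rewrite summxE; apply: eq_bigr => k _; rewrite !mxE eqxx andbT.
exists y; split.
- move=> k; rewrite yE (bigD1 k) //= eqxx mulr1 big1 ?addr0 // => i ik.
  by rewrite (inj_eq gi) eq_sym (negPf ik) mulr0.
- move=> c gc; rewrite yE big1 // => k _.
  have -> : c == g k = false by apply: contraNF gc => /eqP ->; exact: codom_f.
  by rewrite mulr0.
- move=> J u; rewrite mulmx_sumr summxE; apply: eq_bigr => k _.
  by rewrite -scalemxAr mxE -colE mxE mulrC.
Qed.

Lemma underdetermined J A U : (#|U| < #|A|)%N ->
  exists y, [/\ y != 0, forall c, c \notin A -> y c 0 = 0 &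
    forall u, u \in U -> (J *m y) u 0 = 0].
Proof.
move=> UA; pose M : 'M[R]_(#|A|, #|U|) := \matrix_(k, i) J (enum_val i) (enum_val k).
have /rowV0Pn[v /sub_kermxP vM v0] : kermx M != 0.
  rewrite -mxrank_eq0 mxrank_ker -lt0n subn_gt0.
  exact: leq_ltn_trans (rank_leq_col M) UA.
have [y [yg yc Jy]] := spread_vector v (@enum_val_inj _ A).
exists y; split.
- apply: contra_neq v0 => y0; apply/rowP => k.
  by rewrite -yg y0 !mxE.
- move=> c cA; apply: yc; apply: contra cA => /codomP[k ->]; exact: enum_valP.
- move=> u uU; rewrite Jy; have := congr1 (fun B : 'rV_ _ => B 0 (enum_rank_in uU u)) vM.
  rewrite !mxE => vM0; rewrite -[RHS]vM0; apply: eq_bigr => k _.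
  by rewrite mxE enum_rankK_in // mulrC.
Qed.

(** As [y] is supported on the columns of [B], the rows of [J *m y] in [B] are
    those of the block applied to the restriction of [y]. *)
Definition in_block_kernel (B : block n) J y :=
  (forall c, c \notin B.2 -> y c 0 = 0) /\
  (forall u, u \in B.1 -> (J *m y) u 0 = 0).

Lemma block_det_eq0P (B : block n) J : #|B.1| = #|B.2| ->
  block_det B J = 0 <-> exists2 y, y != 0 & in_block_kernel B J y.
Proof.
move=> cB; pose g (k : 'I_#|B.1|) := enum_val (cast_ord cB k).
have gi : injective g by move=> k l /enum_val_inj/cast_ord_inj.
have gB k : g k \in B.2 by exact: enum_valP.
have codg c : (c \in codom g) = (c \in B.2).
  apply/codomP/idP => [[k ->] //|cB2].
  exists (cast_ord (esym cB) (enum_rank_in cB2 c)).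
  by rewrite /g cast_ordKV enum_rankK_in.
rewrite /block_det; set M := (\matrix_(i, k) _ : 'M[R]_#|B.1|).
have gE x0 (k : 'I_#|B.1|) : nth x0 (enum B.2) k = g k by rewrite /g (enum_val_nth x0).
have ME i k : M i k = J (enum_val i) (g k) by rewrite mxE gE.
rewrite -det_tr; split=> [/eqP/det0P[v v0 vM]|[y y0 [ysupp Jy]]].
  have [y [yg yc Jy]] := spread_vector v gi.
  exists y; first by apply: contra_neq v0 => y0; apply/rowP => k; rewrite -yg y0 !mxE.
  split=> [c|u uB]; first by rewrite -codg; exact: yc.
  rewrite Jy; have := congr1 (fun B : 'rV_ _ => B 0 (enum_rank_in uB u)) vM.
  rewrite !mxE => vM0; rewrite -[RHS]vM0; apply: eq_bigr => k _.
  by rewrite mxE ME enum_rankK_in // mulrC.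
apply/eqP/det0P; pose v : 'rV[R]_#|B.1| := \row_k y (g k) 0.
have [y' [yg yc Jy']] := spread_vector v gi.
have yE : y' = y.
  apply/colP => c; have [/codomP[k ->]|cg] := boolP (c \in codom g).
    by rewrite yg mxE.
  by rewrite yc // ysupp // -codg.
exists v.
  apply: contra_neq y0 => v0; apply/colP => c.
  rewrite -yE mxE; have [/codomP[k ->]|] := boolP (c \in codom g); last exact: yc.
  by rewrite yg v0 mxE.
apply/rowP => i.
rewrite mxE [RHS]mxE -[RHS](Jy (enum_val i) (enum_valP i)) -yE Jy'.
by apply: eq_bigr => k _; rewrite [M^T _ _]mxE ME mulrC.
Qed.

End Kernels.

Section SingularBlock.
Variables (R : realType) (n : nat) (G : network n) (m : 'I_n -> 'I_n).
Hypothesis Hm : matching G m.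
Implicit Types (J : 'M[R]_n) (y : 'cV[R]_n) (C : {set 'I_n}).

Lemma card_class_block c : #|(class_block G m c).1| = #|(class_block G m c).2|.
Proof. by rewrite card_imset //; exact: matching_inj Hm. Qed.

Lemma stable_zero J C c c' : network_matrix G J -> stable G m C ->
  c \in C -> c' \notin C -> m c' != input G -> J (m c') c = 0.
Proof.
move=> HJ [oC CC] cC c'C mc'; apply: HJ; apply: contra c'C => e.
apply: (CC c) => //; apply/and3P; split=> //.
  by apply: contraNneq oC => <-.
by apply: contraNneq mc' => ->; rewrite (matching_output Hm).
Qed.

Lemma mul_supported J C y u : (forall c, c \notin C -> y c 0 = 0) ->
  (J *m y) u 0 = \sum_(c in C) J u c * y c 0.
Proof.
move=> yC; rewrite mxE [RHS]big_mkcond /=; apply: eq_bigr => c _.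
by case: ifPn => // /yC ->; rewrite mulr0.
Qed.

(** The parameter acts on the input node only, so responses of equilibria with
    Jacobian [J] satisfy this. *)
Definition input_driven J y := forall u, u != input G -> (J *m y) u 0 = 0.

(** Let [C'] be the reachable columns outside the class.  If the diagonal part of
    [J] over [C'] is singular, a kernel vector of it works, since the columns
    of [C'] vanish on all rows other than those matched with [C'] and the input.
    Otherwise a kernel vector of the block can be corrected on [C'] so that it
    is annihilated by the rows matched with [C'] too. *)
Lemma singular_class_kernel J c : network_matrix G J -> c != output G ->
  block_det (class_block G m c) J = 0 ->
  exists y, [/\ y != 0, input_driven J y &
    forall v, ~~ connect (depends G m) c v -> y v 0 = 0].
Proof.
move=> HJ co /(block_det_eq0P _ (card_class_block c))[z z0 [/= zK Jz]].
pose C := [set v | connect (depends G m) c v]; pose C' := C :\: class G m c.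
have sC : stable G m C := stable_reach m co.
have KC : class G m c \subset C by apply/subsetP => v; rewrite !inE => /andP[].
have sC' : stable G m C'.
  split; first by rewrite inE negb_and (negPf sC.1) orbT.
  move=> x y /setDP[xC xK] xy; rewrite inE (sC.2 x) // andbT.
  apply: contra xK; rewrite inE => /andP[_ yc]; move: xC; rewrite !inE => ->.
  exact: connect_trans (connect1 xy) yc.
(* columns of J over C', completed by the columns of the matching *)
pose M : 'M[R]_n := \matrix_(u, v)
  if v \in C' then (if u == input G then 0 else J u v) else (u == m v)%:R.
have Mrow v (w : 'cV[R]_n) : v \notin C' -> (M *m w) (m v) 0 = w v 0.
  move=> vC; rewrite mxE (bigD1 v) //= mxE (negPf vC) eqxx mul1r big1 ?addr0 // => x xv.
  rewrite mxE; case: ifPn => [xC|_]; last first.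
    by rewrite (inj_eq (matching_inj Hm)) eq_sym (negPf xv) mul0r.
  case: ifPn => [_|mv]; first by rewrite mul0r.
  by rewrite (stable_zero HJ sC' xC vC mv) mul0r.
have Msupp (w : 'cV[R]_n) u : (forall v, v \notin C' -> w v 0 = 0) -> u != input G ->
    (M *m w) u 0 = (J *m w) u 0.
  move=> wC ui; rewrite !(mul_supported _ _ wC); apply: eq_bigr => v vC.
  by rewrite mxE vC (negPf ui).
have [/eqP M0|Mn] := boolP (\det M == 0).
  have /det0P[w w0 wM] : \det M^T == 0 by rewrite det_tr M0.
  have Mw : M *m w^T = 0 by apply: trmx_inj; rewrite trmx_mul trmxK wM trmx0.
  have wC v : v \notin C' -> w^T v 0 = 0 by move=> vC; rewrite -Mrow // Mw mxE.
  exists w^T; split.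
  - by apply: contra_neq w0 => w0; apply: trmx_inj; rewrite w0 trmx0.
  - by move=> u ui; rewrite -Msupp // Mw mxE.
  - by move=> v cv; apply: wC; rewrite !inE (negPf cv) andbF.
have Mu : M \in unitmx by rewrite unitmxE unitfE.
pose z' : 'cV[R]_n := \col_u if u == input G then 0 else (J *m z) u 0.
have [w Mw] : exists w, M *m w = z' by exists (invmx M *m z'); rewrite mulKVmx.
have wC v : v \notin C' -> w v 0 = 0.
  move=> vC'; rewrite -Mrow // Mw mxE; case: ifPn => // mv.
  have [vK|vK] := boolP (v \in class G m c); first by rewrite Jz // imset_f.
  have vC : v \notin C by move: vC'; rewrite in_setD vK.
  rewrite (mul_supported _ _ zK) big1 // => x xK.
  by rewrite (stable_zero HJ sC (subsetP KC x xK) vC mv) mul0r.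
exists (z - w); split.
- have [v zv] : exists v, z v 0 != 0.
    apply/existsP; apply: contraR z0 => /existsPn z0; apply/eqP/colP => v.
    by rewrite mxE; apply/eqP; have := z0 v; rewrite negbK.
  have vK : v \in class G m c by apply: contraNT zv => /zK ->.
  apply: contraNneq zv => zw; have := congr1 (fun B : 'cV_ _ => B v 0) zw.
  rewrite !mxE [X in _ - X]wC ?subr0 => [->//|].
  by rewrite in_setD vK.
- move=> u ui; have wz : (J *m w) u 0 = (J *m z) u 0.
    by rewrite -Msupp // Mw mxE (negPf ui).
  by rewrite mulmxBr mxE [X in _ + X]mxE wz subrr.
- move=> v cv; rewrite !mxE zK; last by rewrite inE (negPf cv).
  by rewrite wC ?subr0 // !inE (negPf cv) andbF.
Qed.

(** By invertibility of [J], two input-driven vectors are proportional. *)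
Lemma singular_class_response J c x v : network_matrix G J -> J \in unitmx ->
  c != output G -> block_det (class_block G m c) J = 0 -> input_driven J x ->
  ~~ connect (depends G m) c v -> x v 0 = 0.
Proof.
move=> HJ Ju co B0 Jx cv; have [y [y0 Jy yv]] := singular_class_kernel HJ co B0.
pose b := (J *m y) (input G) 0; pose a := (J *m x) (input G) 0.
have bxay : b *: x = a *: y.
  apply: (can_inj (mulKmx Ju)); apply/colP => u; rewrite -!scalemxAr.
  rewrite [LHS]mxE [RHS]mxE; have [->|ui] := eqVneq u (input G); first by rewrite mulrC.
  by rewrite Jy // Jx // !mulr0.
have b0 : b != 0.
  apply: contra_neq y0 => b0; apply: (can_inj (mulKmx Ju)); rewrite mulmx0.
  apply/colP => u; rewrite [RHS]mxE.
  by have [->|/Jy] := eqVneq u (input G).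
have := congr1 (fun B : 'cV_ _ => B v 0) bxay.
by rewrite !mxE yv // mulr0 => /eqP; rewrite mulf_eq0 (negPf b0) => /eqP.
Qed.

End SingularBlock.

(** * Polynomial functions on lines and the Lyapunov operator *)

Section PolynomialOnLines.
Variables (R : realType) (V : lmodType R).
Implicit Types (F : V -> R) (x d : V).

(** Enough of polynomiality to compare zero sets: on a line, a finite number of
    polynomials that are not identically zero have a common nonroot. *)
Definition polynomial_on_lines F := forall x d,
  exists p : {poly R}, forall t, F (x + t *: d) = p.[t].

Lemma polynomial_cst (a : R) : polynomial_on_lines (fun=> a).
Proof. by move=> x d; exists a%:P => t; rewrite hornerC. Qed.

Lemma polynomial_affine F :
  (forall x d t, F (x + t *: d) = F x + t * F d) -> polynomial_on_lines F.
Proof.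
move=> FE x d; exists ((F x)%:P + 'X * (F d)%:P) => t.
by rewrite FE !hornerE.
Qed.

Lemma polynomial_add F1 F2 : polynomial_on_lines F1 -> polynomial_on_lines F2 ->
  polynomial_on_lines (fun x => F1 x + F2 x).
Proof.
move=> P1 P2 x d; have [p1 E1] := P1 x d; have [p2 E2] := P2 x d.
by exists (p1 + p2) => t; rewrite hornerD E1 E2.
Qed.

Lemma polynomial_mul F1 F2 : polynomial_on_lines F1 -> polynomial_on_lines F2 ->
  polynomial_on_lines (fun x => F1 x * F2 x).
Proof.
move=> P1 P2 x d; have [p1 E1] := P1 x d; have [p2 E2] := P2 x d.
by exists (p1 * p2) => t; rewrite hornerM E1 E2.
Qed.

Lemma polynomial_sum I (r : seq I) (F : I -> V -> R) :
  (forall i, polynomial_on_lines (F i)) ->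
  polynomial_on_lines (fun x => \sum_(i <- r) F i x).
Proof.
move=> PF; elim: r => [|i r IH] x d.
  by exists 0 => t; rewrite big_nil horner0.
have [p E] := polynomial_add (PF i) IH x d.
by exists p => t; rewrite big_cons E.
Qed.

Lemma polynomial_prod I (r : seq I) (F : I -> V -> R) :
  (forall i, polynomial_on_lines (F i)) ->
  polynomial_on_lines (fun x => \prod_(i <- r) F i x).
Proof.
move=> PF; elim: r => [|i r IH] x d.
  by exists 1 => t; rewrite big_nil hornerE.
have [p E] := polynomial_mul (PF i) IH x d.
by exists p => t; rewrite big_cons E.
Qed.

Lemma polynomial_exp F k : polynomial_on_lines F ->
  polynomial_on_lines (fun x => F x ^+ k).
Proof.
move=> PF x d; have [p E] := PF x d.
by exists (p ^+ k) => t; rewrite horner_exp E.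
Qed.

Lemma polynomial_det N (A : V -> 'M[R]_N) :
  (forall i j, polynomial_on_lines (fun x => A x i j)) ->
  polynomial_on_lines (fun x => \det (A x)).
Proof.
move=> PA; apply: polynomial_sum => s; apply: polynomial_mul.
  exact: polynomial_cst.
by apply: polynomial_prod => i.
Qed.

Lemma exists_nonroot (p : {poly R}) : p != 0 -> exists t, p.[t] != 0.
Proof.
move=> p0; pose s := [seq i%:R : R | i <- iota 0 (size p)].
have us : uniq s by rewrite map_inj_uniq ?iota_uniq // => i k /eqP; rewrite eqr_nat => /eqP.
have := max_poly_roots p0 _ us; rewrite size_map size_iota ltnn => H.
have /allPn[t _ pt] : ~~ all (root p) s by apply/negP => /H.
by exists t.
Qed.

Lemma common_nonzero F1 F2 x y : polynomial_on_lines F1 ->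
  polynomial_on_lines F2 -> F1 x != 0 -> F2 y != 0 ->
  exists t, F1 (x + t *: (y - x)) != 0 /\ F2 (x + t *: (y - x)) != 0.
Proof.
move=> P1 P2 n1 n2; have [p1 E1] := P1 x (y - x); have [p2 E2] := P2 x (y - x).
have : p1 * p2 != 0.
  rewrite mulf_neq0 //.
    by apply: contra_neq n1 => p0; have := E1 0; rewrite scale0r addr0 p0 horner0.
  by apply: contra_neq n2 => p0; have := E2 1; rewrite scale1r addrC subrK p0 horner0.
case/exists_nonroot=> t; rewrite hornerM mulf_eq0 negb_or -E1 -E2 => /andP[].
by exists t.
Qed.

Lemma nonzero_nearby F x d : polynomial_on_lines F -> F x != 0 ->
  exists2 t, t != 0 & F (x + t *: d) != 0.
Proof.
move=> PF n1; have [p E] := PF x d.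
have : 'X * p != 0.
  rewrite mulf_neq0 ?polyX_eq0 //.
  by apply: contra_neq n1 => p0; have := E 0; rewrite scale0r addr0 p0 horner0.
case/exists_nonroot=> t; rewrite hornerM hornerX mulf_eq0 negb_or -E => /andP[].
by exists t.
Qed.

End PolynomialOnLines.

Section Lyapunov.
Variables (R : realType) (n : nat).
Implicit Types (J M : 'M[R]_n).

(** The eigenvalues of the operator [M |-> J^T M + M J] are the sums of two
    eigenvalues of [J].  Its determinant is a polynomial in [J] which vanishes
    whenever [J] has an eigenvalue on the imaginary axis. *)
Definition lyapunov J := mulmx J^T \+ mulmxr J.

Definition lyapunov_det J : R := \det (lin_mx (lyapunov J)).

Lemma lyapunov_detP J :
  lyapunov_det J != 0 <-> forall M, lyapunov J M = 0 -> M = 0.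
Proof.
split=> [d0 M JM|inj].
  apply: contra_neq_eq d0 => M0; apply/eqP/det0P.
  exists (mxvec M); first by rewrite mxvec_eq0.
  by apply/eqP; rewrite mul_vec_lin mxvec_eq0; apply/eqP.
apply/negP => /det0P[v v0 vJ]; move: v0; rewrite -[v]vec_mxK mxvec_eq0.
apply/negP; rewrite negbK; apply/eqP/inj; apply/eqP.
by rewrite -mxvec_eq0 -mul_vec_lin vec_mxK vJ.
Qed.

(** An eigenvector [x + i y] for the eigenvalue [i w] spans a plane on which [J]
    acts as an infinitesimal rotation; the quadratic form [x^T x + y^T y] is
    then in the kernel of the operator. *)
Lemma lyapunov_rotation J (x y : 'rV[R]_n) (w : R) :
  lyapunov_det J != 0 -> x *m J = - w *: y -> y *m J = w *: x -> x = 0 /\ y = 0.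
Proof.
move=> /lyapunov_detP inj xJ yJ.
have /inj M0 : lyapunov J (x^T *m x + y^T *m y) = 0.
  rewrite /lyapunov /= mulmxDr mulmxDl !mulmxA -!trmx_mul -!mulmxA xJ yJ.
  rewrite !linearZ /= -!scalemxAl !scaleNr.
  by rewrite addrA addrK addNr.
have sq i : x 0 i ^+ 2 + y 0 i ^+ 2 = 0.
  have := congr1 (fun B : 'M[R]_n => B i i) M0; rewrite !mxE => <-.
  by rewrite !big_ord1 !mxE !expr2.
split; apply/rowP => i; rewrite mxE; have /eqP := sq i;
  by rewrite paddr_eq0 ?sqr_ge0 // !sqrf_eq0 => /andP[/eqP ? /eqP ?].
Qed.

Lemma lyapunov_unitmx J : lyapunov_det J != 0 -> J \in unitmx.
Proof.
move=> d0; rewrite unitmxE unitfE; apply/det0P => -[x x0 xJ].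
have [] := @lyapunov_rotation J x 0 0 d0; rewrite ?xJ ?scaler0 ?mul0mx ?scale0r //.
by move=> /eqP; rewrite (negPf x0).
Qed.

(** All eigenvalues are 1, as [J] is triangular for the order given by [h].
    Concretely, each entry [M i l] of a kernel element is determined by entries
    with a larger value of [h i + h l]. *)
Lemma unipotent_lyapunov J (h : 'I_n -> nat) :
  (forall i, J i i = 1) ->
  (forall i k, i != k -> J i k != 0 -> (h k < h i)%N) -> lyapunov_det J != 0.
Proof.
move=> J1 Jh; apply/lyapunov_detP => M JM.
have [N Nh] : exists N, forall i, (h i <= N)%N.
  by exists (\max_i h i)%N => i; exact: leq_bigmax.
suff M0 k i l : (N + N - (h i + h l) < k)%N -> M i l = 0.
  by apply/matrixP => i l; rewrite mxE; apply: M0 (ltnSn _).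
elim: k i l => // k IH i l; rewrite ltnS => lek.
have := congr1 (fun B : 'M[R]_n => B i l) JM; rewrite !mxE.
rewrite (bigD1 i) //= [X in _ + X](bigD1 l) //= !mxE !J1 mul1r mulr1.
rewrite [X in M i l + X + _]big1 ?[X in _ + (_ + X)]big1 ?addr0.
- by move/eqP; rewrite -mulr2n mulrn_eq0 => /eqP.
- move=> u ul; have [->|Jul] := eqVneq (J u l) 0; first by rewrite mulr0.
  rewrite IH ?mul0r //; have := Jh _ _ ul Jul; have := Nh u; have := Nh i.
  by lia.
- move=> u ui; rewrite mxE; have [->|Jul] := eqVneq (J u i) 0; first by rewrite mul0r.
  rewrite IH ?mulr0 //; have := Jh _ _ ui Jul; have := Nh u; have := Nh l.
  by lia.
Qed.

End Lyapunov.

Lemma breadth_first_tree (T : finType) (e : rel T) (r : T) :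
  exists (h : T -> nat) (par : T -> T), forall v, connect e r v -> v != r ->
    [/\ connect e r (par v), e (par v) v & (h (par v) < h v)%N].
Proof.
have /choice[h hP] v : exists k, connect e r v ->
    (exists2 s, path e r s & last r s = v /\ size s = k) /\
    (forall s, path e r s -> last r s = v -> (k <= size s)%N).
  have [/connectP[s0 p0 l0]|nv] := boolP (connect e r v); last by exists 0%N.
  pose P k := `[< exists2 s, path e r s & last r s = v /\ size s = k >].
  have exP : exists k, P k by exists (size s0); apply/asboolP; exists s0.
  case: (ex_minnP exP) => k /asboolP Pk kmin; exists k => _; split=> // s ps ls.
  by apply: kmin; apply/asboolP; exists s.
have /choice[par parP] v : exists u, connect e r v -> v != r ->
    [/\ connect e r u, e u v & (h u < h v)%N].
  have [rv|nv] := boolP (connect e r v); last by exists r.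
  have [[s ps [ls sE]] _] := hP v rv.
  case/lastP: s ps ls sE => [|s x] /=.
    by move=> _ ->; exists r; rewrite eqxx.
  rewrite rcons_path last_rcons size_rcons => /andP[ps ex] xv sE; subst x.
  have rl : connect e r (last r s) by apply/connectP; exists s.
  exists (last r s) => _ _; split=> //.
  by have [_ /(_ s ps erefl)] := hP _ rl; rewrite -sE ltnS.
by exists h, par.
Qed.

(** * Kernel vectors without zero entries *)

Section FullKernel.
Variables (R : realType) (n : nat) (G : network n) (m : 'I_n -> 'I_n) (c : 'I_n).
Hypotheses (Hm : matching G m) (co : c != output G).
Local Notation K := (class G m c).
Local Notation B := (class_block G m c).
Implicit Types (J : 'M[R]_n) (y : 'cV[R]_n).

Local Notation zeros y := [set v in K | y v 0%R == 0%R].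

(** The rows [U] of the block that only meet zeros of [y] are fewer than these
    zeros [Z], by irreducibility.  So some nonzero [w] supported on [Z] is
    annihilated by the rows in [U].  Moving the kernel vector along [y + t w],
    the other rows are corrected in one entry, at a column where [y] is nonzero;
    this moves the matrix along a line. *)
Lemma larger_kernel_support (F : 'M[R]_n * R^o -> R) J a y :
  polynomial_on_lines F -> network_matrix G J -> y != 0 ->
  in_block_kernel B J y -> F (J, a) != 0 ->
  zeros y != set0 ->
  exists J' y', [/\ network_matrix G J', y' != 0, in_block_kernel B J' y',
    F (J', a) != 0 &
    (#|zeros y'| < #|zeros y|)%N].
Proof.
set Z := zeros y.
move=> PF HJ y0 [/= yK Jy] F0 Z0.
pose Y := K :\: Z.
have YE v : (v \in Y) = (y v 0 != 0).
  rewrite in_setD in_set; have [vK|/yK ->] := boolP (v \in K); last first.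
    by rewrite eqxx andbF.
  by rewrite andbT.
have YK : Y \subset K by exact: subsetDl.
have ZK : Z \subset K by apply/subsetP => v; rewrite inE => /andP[].
have Y0 : Y != set0.
  apply: contra_neq y0 => Y0; apply/colP => v; rewrite mxE; apply/eqP.
  by apply: contraT; rewrite -YE Y0 inE.
pose U := [set u in m @: K | [forall v in Y, ~~ nonzero_entry G u v]].
have UZ : (#|U| < #|Z|)%N.
  rewrite ltnNge; apply/negP => ZU.
  have YU : m @: Y = m @: K :\: U.
    apply/eqP; rewrite eqEcard; apply/andP; split.
      apply/subsetP => _ /imsetP[v vY ->]; rewrite !inE imset_f ?(subsetP YK) // andbT /=.
      apply/forall_inP => /(_ v vY)/negP; apply; apply: matching_entry => //.
      by apply: contraNneq (class_output m co) => <-; exact: (subsetP YK).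
    rewrite (card_imset _ (matching_inj Hm)) !cardsD card_imset; last exact: matching_inj Hm.
    rewrite (setIidPr ZK) (setIidPr _); first exact: leq_sub2l.
    by apply/subsetP => u; rewrite inE => /andP[].
  have YKE : Y = K.
    apply: (class_closed Y0 YK) => x x' xY x'K /and3P[_ _ e].
    rewrite -(mem_matching_image _ _ Hm) YU in_setD imset_f // andbT.
    by rewrite inE imset_f //= negb_forall_in; apply/exists_inP; exists x; rewrite ?negbK.
  by case/set0Pn: Z0 => v vZ; have := subsetP ZK v vZ; rewrite -YKE in_setD vZ.
have [w [w0 wZ Jw]] := underdetermined J UZ.
(* each row outside U gets a pivot, on which the kernel vector is kept fixed *)
pose pivot u := odflt c [pick v in Y | nonzero_entry G u v].
have pivotP u : u \in m @: K -> u \notin U -> pivot u \in Y /\ nonzero_entry G u (pivot u).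
  move=> uK; rewrite inE uK /= negb_forall_in => /exists_inP[v vY]; rewrite negbK => uv.
  by rewrite /pivot; case: pickP => [x /andP[]//|/(_ v)]; rewrite vY uv.
pose D : 'M[R]_n := \matrix_(u, v)
  (- (J *m w) u 0 / y (pivot u) 0 *+ [&& u \in m @: K, u \notin U & v == pivot u]).
have Dx (x : 'cV[R]_n) u : u \in m @: K -> u \notin U ->
    (D *m x) u 0 = - (J *m w) u 0 / y (pivot u) 0 * x (pivot u) 0.
  move=> uK uU; rewrite mxE (bigD1 (pivot u)) //= [D _ _]mxE uK uU eqxx mulr1n.
  by rewrite big1 ?addr0 // => v vp; rewrite [D _ _]mxE (negPf vp) !andbF mulr0n mul0r.
have D0 (x : 'cV[R]_n) u : u \in U -> (D *m x) u 0 = 0.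
  by move=> uU; rewrite mxE big1 // => v _; rewrite [D _ _]mxE uU andbF mulr0n mul0r.
have [t t0 Ft] := nonzero_nearby (D, 0) PF F0.
have wY v : v \in Y -> w v 0 = 0 by move=> vY; apply: wZ; move: vY; rewrite in_setD => /andP[].
have yE v : v \in Y -> (y + t *: w) v 0 = y v 0.
  by move=> vY; rewrite mxE [X in _ + X]mxE wY // mulr0 addr0.
have [v wv] : exists v, w v 0 != 0.
  apply/existsP; apply: contraR w0 => /existsPn w0; apply/eqP/colP => v.
  by rewrite mxE; apply/eqP; have := w0 v; rewrite negbK.
have vZ : v \in Z by apply: contraNT wv => /wZ ->.
have yv : (y + t *: w) v 0 != 0.
  rewrite mxE [X in _ + X]mxE; move: vZ; rewrite inE => /andP[_ /eqP ->].
  by rewrite add0r mulf_neq0.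
exists (J + t *: D), (y + t *: w); split.
- move=> u x ux; rewrite mxE HJ // add0r mxE [D _ _]mxE.
  case: and3P => [[uK uU /eqP xE]|_]; last by rewrite mulr0n mulr0.
  by have [_] := pivotP u uK uU; rewrite -xE (negPf ux).
- by apply: contra_neq yv => ->; rewrite mxE.
- split=> /= [x xK|u uK].
    rewrite mxE yK // add0r mxE wZ ?mulr0 //.
    by apply: contra xK; exact: (subsetP ZK).
  rewrite mulmxDl !mulmxDr -!scalemxAl -!scalemxAr.
  rewrite ![(_ + _ : 'cV_n) u 0]mxE Jy // add0r ![(_ *: _ : 'cV_n) u 0]mxE.
  have [uU|uU] := boolP (u \in U).
    by rewrite !D0 // Jw // !mulr0 !addr0.
  have [pY _] := pivotP u uK uU; rewrite !Dx // wY // mulr0 !mulr0 addr0.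
  by rewrite mulfVK ?mulrN ?subrr // -YE.
- by move: Ft; rewrite [X in F X]surjective_pairing /= scaler0 addr0.
- apply/proper_card/properP; split; last first.
    by exists v => //; rewrite inE (negPf yv) andbF.
  apply/subsetP => x; rewrite !inE => /andP[xK]; rewrite xK /=.
  by apply: contraLR; rewrite -YE => xY; rewrite yE // -YE.
Qed.

Lemma full_kernel (F : 'M[R]_n * R^o -> R) J a :
  polynomial_on_lines F -> network_matrix G J -> block_det B J = 0 ->
  F (J, a) != 0 ->
  exists J' y', [/\ network_matrix G J', in_block_kernel B J' y',
    F (J', a) != 0 & forall v, v \in K -> y' v 0 != 0].
Proof.
move=> PF HJ /(block_det_eq0P _ (card_class_block Hm c))[y y0 Jy] F0.
have [k] := ubnP #|zeros y|.
elim: k J y HJ y0 Jy F0 => // k IH J y HJ y0 Jy F0; rewrite ltnS => lek.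
have [Z0|Z0] := eqVneq (zeros y) set0.
  exists J, y; split=> // v vK; apply/negP => yv.
  by have := in_set0 v; rewrite -Z0 inE vK yv.
have [J' [y' [HJ' y'0 Jy' F0' lt]]] := larger_kernel_support PF HJ y0 Jy F0 Z0.
exact: (IH J' y' HJ' y'0 Jy' F0' (leq_trans lt lek)).
Qed.

End FullKernel.

(** * A generic point of the singular hypersurface *)

Section PolynomialsInTheJacobian.
Variables (R : realType) (n : nat).
Local Notation point := ('M[R]_n * R^o)%type.

Lemma polynomial_partials (P : mpoly.mpoly (n * n + 1) R) :
  polynomial_on_lines (fun z : point => eval_partials P z.1 z.2).
Proof.
move=> x d.
pose v k (z : point) : R := row_mx (mxvec z.1) (z.2%:M : 'M[R]_1) 0 k.
pose F (i : mpoly.multinom (n * n + 1)) z :=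
  mpoly.mcoeff i P * \prod_k v k z ^+ mpoly.fun_of_multinom i k.
have vP k : polynomial_on_lines (v k).
  apply: polynomial_affine => {}x {}d t.
  rewrite /v linearD linearZ /= raddfD /= -add_row_mx -scale_scalar_mx.
  by rewrite -scale_row_mx !mxE.
have FP i : polynomial_on_lines (F i).
  apply: polynomial_mul; first exact: polynomial_cst.
  by apply: polynomial_prod => k; apply: polynomial_exp.
have [p pE] := polynomial_sum (mpoly.msupp P) FP x d.
by exists p => t; rewrite -pE /eval_partials mpoly.mevalE.
Qed.

Lemma polynomial_adjugate i k : polynomial_on_lines (fun z : point => (\adj z.1) i k).
Proof.
move=> x d.
have CP : polynomial_on_lines (fun z : point => cofactor z.1 k i).
  apply: polynomial_mul; first exact: polynomial_cst.
  by apply: polynomial_det => u v; apply: polynomial_affine => {}x {}d t; rewrite !mxE.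
by have [p pE] := CP x d; exists p => t; rewrite mxE.
Qed.

Lemma polynomial_lyapunov_det :
  polynomial_on_lines (fun z : point => lyapunov_det z.1).
Proof.
apply: polynomial_det => i k; apply: polynomial_affine => x d t.
have LE (J : 'M[R]_n) : lin_mx (lyapunov J) i k =
    mxvec (lyapunov J (vec_mx (delta_mx 0 i))) 0 k by rewrite mxE.
have lyapD (J D M : 'M[R]_n) :
    lyapunov (J + t *: D) M = lyapunov J M + t *: lyapunov D M.
  rewrite /lyapunov /= (_ : (J + t *: D)^T = J^T + t *: D^T); last first.
    by apply/matrixP => u v; rewrite !mxE.
  rewrite mulmxDl mulmxDr.
  by rewrite -scalemxAl -scalemxAr addrACA -scalerDr.
by rewrite !LE lyapD linearD linearZ !mxE.
Qed.
End PolynomialsInTheJacobian.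

Section GenericPoint.
Variables (R : realType) (n : nat) (G : network n) (q : nat) (rho : 'I_q.+2 -> 'I_n).
Hypotheses (hcore : core G) (hrho : super_simple_order G rho).
Variables (m : 'I_n -> 'I_n) (j : 'I_q.+1).
Hypothesis Hm : matching G m.
Local Notation a := (rho_pred rho j).
Local Notation d := (rho_succ rho j).
Local Notation K := (class G m a).
Local Notation B := (class_block G m a).

(** The initial segment of an io-simple path up to [rho_j], followed by the
    class: every column of the class is reached from [rho_j] by arrows inside
    the class.  The columns [X] that are so reached have nonzero entries in no
    more than [#|X|] rows of the block, as no arrow leads from [X] to the rest
    of the class; by irreducibility they form the whole class. *)
Lemma tree_in_class : exists (T : {set 'I_n}) (h : 'I_n -> nat) (par : 'I_n -> 'I_n),
  [/\ K \subset T, forall k : 'I_q.+2, (k <= j)%N -> rho k \in T,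
     d \notin T, input G \in T &
     forall v, v \in T -> v != input G ->
     [/\ par v \in T, arrow G (par v) v, (h (par v) < h v)%N &
         v \in K -> v != a -> par v \in K]].
Proof.
have [p ip] := core_io_simple_path hcore.
have rp k : rho k \in p by exact: (super_simple_rho hrho _ ip).
have lt := index_rho_pred_succ hcore hrho j ip.
pose S := [set v | (v \in p) && (index v p <= index a p)%N].
have SK v : v \in S -> v \in K -> v = a.
  rewrite inE => /andP[vp le]; rewrite (class_index hcore hrho _ Hm ip vp) => /andP[ge _].
  by apply: (index_inj v vp (rp _)); apply/eqP; rewrite eqn_leq le ge.
have aK : a \in K by exact: class_refl.
have aS : a \in S by rewrite inE leqnn andbT; exact: rp.
have iS : input G \in S by rewrite inE io_simple_path_input // index_input.
pose e x v := arrow G x v && ((x \in K) && (v \in K) && (v != a) || (x \in S) && (v \in S)).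
have reachS v : v \in S -> connect e (input G) v.
  rewrite inE => /andP[vp le].
  have [k] := ubnP (index v p); elim: k v vp le => // k IH v vp le.
  rewrite ltnS => lek.
  have [->|vi] := eqVneq v (input G); first exact: connect0.
  pose u := prev p v; have up : u \in p by rewrite mem_prev.
  have vE : v = next p u by rewrite next_prev // (io_simple_path_uniq ip).
  have uo : u != output G.
    by apply: contraNneq vi => uo; rewrite vE uo (next_output ip).
  have iu : index v p = (index u p).+1 by rewrite [in LHS]vE (index_next ip).
  have le' : (index u p <= index a p)%N by apply: leq_trans le; rewrite iu.
  apply: connect_trans (IH u up le' _) (connect1 _); first by rewrite -iu.
  rewrite /e [in arrow _ _ _]vE (arrow_next ip) //=; apply/orP; right.
  by rewrite !inE up vp le le'.
pose X := [set v in K | connect e (input G) v].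
have XK : X = K.
  have XsK : X \subset K by apply/subsetP => v; rewrite inE => /andP[].
  have aX : a \in X by rewrite inE aK reachS.
  have Ko v : v \in K -> v != output G.
    by apply: contraTneq => ->; apply: class_output; exact: rho_pred_output.
  have stepX v v' : v \in X -> v' \in m @: K -> nonzero_entry G v' v ->
      v' \in K -> v' \in X.
    move=> vX; rewrite (class_rows hcore hrho _ Hm); have [->|_ /=] := eqVneq v' d.
      by rewrite (negPf (rho_succ_class hcore hrho _ Hm)).
    case/andP=> v'K v'a /orP[/eqP -> //|vv'] _; rewrite inE v'K.
    move: vX; rewrite inE => /andP[vK iv]; apply: connect_trans iv (connect1 _).
    by rewrite /e vv' vK v'K v'a.
  have mX : m @: X = m @: K :\: (K :\: X).
    apply/eqP; rewrite eqEcard; apply/andP; split.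
      apply/subsetP => _ /imsetP[v vX ->].
      have vK := subsetP XsK v vX; have mvK : m v \in m @: K by exact: imset_f.
      rewrite in_setD mvK andbT in_setD negb_and negbK orbC -implybE.
      apply/implyP; apply: stepX vX mvK _; exact: matching_entry (Ko _ vK).
    rewrite cardsD (setIidPr _); last first.
      apply/subsetP => v /setDP[vK vX]; rewrite (class_rows hcore hrho _ Hm) vK /=.
      by rewrite orbC; case: eqP vX => // ->; rewrite aX.
    rewrite !(card_imset _ (matching_inj Hm)) cardsD (setIidPr XsK).
    by rewrite subKn // subset_leq_card.
  apply: (class_closed (m := m)) XsK _; first by apply/set0Pn; exists a.
  move=> v v' vX v'K /and3P[_ _ e'].
  rewrite -(mem_matching_image _ _ Hm) mX in_setD imset_f // andbT.
  rewrite in_setD negb_and negbK orbC -implybE.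
  by apply/implyP; apply: (stepX v) => //; exact: imset_f.
pose T := S :|: K.
have reachT v : v \in T -> connect e (input G) v.
  rewrite in_setU => /orP[/reachS //|]; rewrite -XK inE => /andP[].
  by [].
have [h [par parP]] := breadth_first_tree e (input G).
exists T, h, par; split.
- exact: subsetUr.
- move=> k kj; rewrite in_setU inE rp /=; apply/orP; left.
  rewrite leqNgt (rho_index hcore hrho) // -leqNgt.
  exact: kj.
- rewrite in_setU negb_or (rho_succ_class hcore hrho _ Hm) andbT inE negb_and.
  by rewrite -ltnNge lt orbT.
- by rewrite in_setU iS.
- move=> v /reachT iv vi; have [_ /andP[pv cases] hlt] := parP v iv vi.
  split=> //.
    by case/orP: cases => [/andP[/andP[pK _] _]|/andP[pS _]]; rewrite in_setU ?pK ?pS ?orbT.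
  move=> vK va; case/orP: cases => [/andP[/andP[-> _] _] //|/andP[pS vS]].
  by rewrite (SK v vS vK) eqxx in va.
Qed.
(** The row of each node [v] of the tree equates [w v] to a multiple of [w] at
    the parent of [v].  So [w] can be prescribed on the tree: equal to [y] on
    the class, and constant on the segment before it. *)
Lemma tree_matrix (y : 'cV[R]_n) : (forall v, v \in K -> y v 0 != 0) ->
  (forall v, v \notin K -> y v 0 = 0) ->
  exists (J : 'M[R]_n) (w : 'cV[R]_n),
  [/\ network_matrix G J, in_block_kernel B J y, lyapunov_det J != 0,
     input_driven G J w & forall k : 'I_q.+2, (k <= j)%N -> w (rho k) 0 != 0].
Proof.
move=> yK yK0; have [T [h [par [KT rhoT dT iT tree]]]] := tree_in_class.
have aK : a \in K by exact: class_refl.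
pose w : 'cV[R]_n := \col_v if v \in K then y v 0 else y a 0 *+ (v \in T).
have wE v : v \in K -> w v 0 = y v 0 by move=> vK; rewrite mxE vK.
have wT v : v \in T -> w v 0 != 0.
  by move=> vT; rewrite mxE vT; case: ifP => [/yK //|_]; rewrite mulr1n; exact: yK.
have w0 v : v \notin T -> w v 0 = 0.
  move=> vT; rewrite mxE (negPf vT) ifN //; apply: contra vT; exact: (subsetP KT).
pose J : 'M[R]_n := \matrix_(u, v) ((u == v)%:R -
  (w u 0 / w (par u) 0) *+ [&& u \in T, u != input G & v == par u]).
have parN u : u \in T -> u != input G -> par u != u.
  by move=> uT ui; have [_ _ lt _] := tree u uT ui; apply: contraTneq lt => ->; rewrite ltnn.
have Jx (x : 'cV[R]_n) u : (J *m x) u 0 =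
    x u 0 - (w u 0 / w (par u) 0 * x (par u) 0) *+ ((u \in T) && (u != input G)).
  rewrite mxE; under eq_bigr => v _ do rewrite [J _ _]mxE mulrBl.
  rewrite big_split /= sumrN; congr (_ - _).
    rewrite (bigD1 u) //= eqxx mul1r big1 ?addr0 // => v vu.
    by rewrite eq_sym (negPf vu) mul0r.
  rewrite (bigD1 (par u)) //= eqxx andbT big1 ?addr0 ?mulrnAl // => v vp.
  by rewrite (negPf vp) !andbF mulr0n mul0r.
exists J, w; split.
- move=> u v uv; rewrite mxE; have := uv; rewrite negb_or => /andP[/negPf -> uv'].
  case: and3P => [[uT ui /eqP vE]|_]; last by rewrite subr0.
  by have [_ + _ _] := tree u uT ui; rewrite -vE (negPf uv').
- split=> //= u; rewrite (class_rows hcore hrho _ Hm) Jx => /orP[/eqP->|/andP[uK ua]].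
    rewrite (negPf dT) subr0.
    by apply: yK0; exact: (rho_succ_class hcore hrho _ Hm).
  have uT := subsetP KT u uK; rewrite uT /=; have ui : u != input G.
    apply: contraNneq ua => ui; have [_] := class_avoiding hcore hrho Hm uK.
    by rewrite ui inE connect0 andbT negbK.
  have [pT _ _ /(_ uK ua) pK] := tree u uT ui.
  by rewrite ui mulr1n (wE u uK) (wE _ pK) mulfVK ?subrr // yK.
- apply: (unipotent_lyapunov (h := fun v => if v \in T then h v else 0%N)).
    move=> u; rewrite mxE eqxx; case: and3P => [[uT ui /eqP uE]|_]; last by rewrite subr0.
    by have := parN u uT ui; rewrite -uE eqxx.
  move=> u v uv; rewrite mxE (negPf uv) sub0r oppr_eq0.
  case: and3P => [[uT ui /eqP ->] _|_]; last by rewrite mulr0n eqxx.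
  by have [pT _ lt _] := tree u uT ui; rewrite uT pT.
- move=> u ui; rewrite Jx ui andbT; have [uT|/w0 ->] := boolP (u \in T); last by rewrite subr0.
  have [pT _ _ _] := tree u uT ui.
  by rewrite mulr1n divfK ?subrr //; exact: wT.
- by move=> k kj; apply: wT; exact: rhoT.
Qed.

(** The kernel condition for a fixed vector [y] is linear in the matrix, so the
    line joining the two matrices stays in the hypersurface.  The second
    polynomial is nonzero at the tree matrix by Cramer's rule. *)
Lemma generic_point (P : mpoly.mpoly (n * n + 1) R) (J0 : 'M[R]_n) (a0 : R) (k : 'I_q.+2) :
  (k <= j)%N -> network_matrix G J0 -> block_det B J0 = 0 ->
  eval_partials P J0 a0 != 0 ->
  exists (J : 'M[R]_n) (a : R),
  [/\ network_matrix G J, block_det B J = 0, eval_partials P J a != 0,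
     lyapunov_det J != 0 & a * (\adj J) (rho k) (input G) != 0].
Proof.
move=> kj HJ0 B0 P0; have ao := rho_pred_output hcore hrho j.
pose F (z : 'M[R]_n * R^o) : R := eval_partials P z.1 z.2.
have [J1 [y [HJ1 [yK0 Jy1] F1 yK]]] :=
  full_kernel (F := F) Hm ao (polynomial_partials P) HJ0 B0 P0.
have [J2 [w [HJ2 [_ Jy2] ly2 Jw wk]]] := tree_matrix yK yK0.
pose F' (z : 'M[R]_n * R^o) : R :=
  lyapunov_det z.1 * ((\adj z.1) (rho k) (input G) * z.2).
have PF' : polynomial_on_lines F'.
  apply: polynomial_mul; first exact: polynomial_lyapunov_det.
  apply: polynomial_mul; first exact: polynomial_adjugate.
  exact: polynomial_affine.
have F2 : F' (J2, 1 : R^o) != 0.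
  rewrite /F' /= mulr1 mulf_neq0 //.
  have : (\adj J2 *m (J2 *m w)) (rho k) 0 != 0.
    rewrite mulmxA mul_adj_mx mul_scalar_mx mxE mulf_neq0 ?wk //.
    by have := lyapunov_unitmx ly2; rewrite unitmxE unitfE.
  rewrite mxE (bigD1 (input G)) //= big1 ?addr0; last first.
    by move=> u ui; rewrite Jw // mulr0.
  by rewrite mulf_eq0 negb_or => /andP[].
have [t [Ft F't]] := common_nonzero (F1 := F) (polynomial_partials P) PF' F1 F2.
exists (J1 + t *: (J2 - J1)), (a0 + t * (1 - a0)).
rewrite [X in F X]surjective_pairing /= in Ft.
rewrite [X in F' X]surjective_pairing /F' /= mulf_eq0 negb_or in F't.
case/andP: F't => lyt; rewrite mulrC => at0; split=> //.
- by move=> u v uv; rewrite !mxE HJ1 // HJ2 // subrr mulr0 addr0.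
- apply/(block_det_eq0P _ (card_class_block Hm _)); exists y.
    apply: contraNneq (yK _ (class_refl G m a)) => ->; first by rewrite mxE.
  split=> // u uB; rewrite mulmxDl -scalemxAl mulmxBl.
  have lineE (A C : 'cV[R]_n) : (A + t *: (C - A)) u 0 = A u 0 + t * (C u 0 - A u 0).
    by rewrite !mxE.
  by rewrite lineE Jy1 // Jy2 // subrr mulr0 addr0.
Qed.
End GenericPoint.

(** * Hyperbolicity and polynomial maps *)

Section Hyperbolicity.
Variables (R : realType) (n : nat).

Lemma lyapunov_hyperbolic (J : 'M[R]_n) : lyapunov_det J != 0 ->
  forall z : complex R, eigenvalue (map_mx (real_complex R) J) z ->
    complex.Re z != 0.
Proof.
move=> d0 z /eigenvalueP[v vJ v0]; apply: contraNneq v0 => z0.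
pose x : 'rV[R]_n := \row_i complex.Re (v 0 i).
pose y : 'rV[R]_n := \row_i complex.Im (v 0 i).
have vJE l : (v *m map_mx (real_complex R) J) 0 l =
    Complex ((x *m J) 0 l) ((y *m J) 0 l).
  rewrite !mxE; elim/big_rec3: _ => // i b c u _ ->; rewrite !mxE.
  by case: (v 0 i) => r s; rewrite /real_complex_def /=; simpc.
have zE : z = Complex 0 (complex.Im z) by case: z z0 {vJ} => r s /= ->.
have vE l : z * v 0 l = Complex (- complex.Im z * y 0 l) (complex.Im z * x 0 l).
  rewrite zE !mxE /=; case: (v 0 l) => r s /=.
  by simpc.
have [x0 y0] : x = 0 /\ y = 0.
  apply: (lyapunov_rotation (w := complex.Im z) d0); apply/rowP => l.
  - have := vJE l; rewrite vJ mxE vE => -[<- _]; by rewrite [RHS]mxE.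
  - have := vJE l; rewrite vJ mxE vE => -[_ <-]; by rewrite [RHS]mxE.
apply/eqP/rowP => l; rewrite mxE.
have /rowP/(_ l) := x0; have /rowP/(_ l) := y0; rewrite !mxE.
by case: (v 0 l) => r s /= -> ->.
Qed.

Lemma hyperbolic_unitmx (f : system R n) X0 I0 :
  hyperbolic_equilibrium f X0 I0 -> jacobian_at f X0 I0 \in unitmx.
Proof.
case=> _ hyp; rewrite unitmxE unitfE; apply/det0P => -[v v0 vJ].
suff /hyp : eigenvalue (map_mx (real_complex R) (jacobian_at f X0 I0)) 0.
  by rewrite /= eqxx.
apply/eigenvalueP; exists (map_mx (real_complex R) v).
  by rewrite -map_mxM vJ scale0r; apply/rowP => i; rewrite !mxE.
by rewrite map_mx_eq0.
Qed.

End Hyperbolicity.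

Section Calculus.
Local Open Scope classical_set_scope.
Variable R : realType.

(** All derivatives that have to be computed are those of functions which are
    quadratic along the line in question. *)
Lemma derive_quadratic (V : normedModType R) (g : V -> R) (x v : V) (c e : R) :
  (forall h, g (h *: v + x) = g x + h * c + h ^+ 2 * e) -> 'D_v g x = c.
Proof.
move=> gE; rewrite /derive; apply: cvg_lim => //.
apply: (@cvg_trans _ ((fun h : R => c + h * e) @ 0^')).
  apply: near_eq_cvg; near=> h; rewrite /= gE /GRing.scale /=.
  have h0 : h != 0 by near: h; exact: nbhs_dnbhs_neq.
  by field.
suff : (fun h : R => c + h * e) @ 0^' --> c + 0 * e by rewrite mul0r addr0.
apply: cvgD; first exact: cvg_cst.
apply: cvgM; last exact: cvg_cst.
exact: nbhs_dnbhs.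
Unshelve. all: by end_near. Qed.

Lemma linear_function (V : lmodType R) (g : V -> R) :
  (forall a x y, g (a *: x + y) = a * g x + g y) ->
  exists l : {linear V -> R}, (l : _ -> _) = g.
Proof.
move=> gl; pose gM := GRing.isLinear.Build _ _ _ _ g gl.
by exists (HB.pack g gM : {linear _ -> _}).
Qed.

Lemma derive_coord (V : normedModType R) n (F : V -> 'rV[R]_n) (x v : V) i :
  differentiable F x ->
  'D_v (fun y => F y 0 i) x = ('D_v F x) 0 i.
Proof.
move=> dF.
have [l lE] : exists l : {linear 'rV[R]_n -> R}, (l : _ -> _) = fun N => N 0 i.
  by apply: linear_function => a M N; rewrite !mxE.
have lc : continuous l by rewrite lE; exact: coord_continuous.
have dl : differentiable l (F x) by exact: linear_differentiable.
have -> : (fun y => F y 0 i) = l \o F by rewrite lE.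
rewrite deriveE; last exact: differentiable_comp.
by rewrite diff_comp // diff_lin // lE /= deriveE.
Qed.

Lemma differentiable_coords (V : normedModType R) n (F : V -> 'rV[R]_n) (x : V) :
  (forall i, differentiable (fun y => F y 0 i) x) -> differentiable F x.
Proof.
move=> dF.
have -> : F = \sum_(i < n) (fun y => F y 0 i *: (delta_mx 0 i : 'rV[R]_n)).
  apply/funext => y; rewrite fct_sumE [LHS]row_sum_delta.
  by [].
by apply: differentiable_sum => i; exact: differentiableZl.
Qed.

(** A class of functions stable under directional derivatives, all of whose
    members are differentiable: hence consisting of smooth functions. *)
Inductive polynomial_map (V : normedModType R) : (V -> R) -> Prop :=
| PolyCst c : polynomial_map (cst c)
| PolyLin (l : {linear V -> R}) : continuous l -> polynomial_map l
| PolyAdd g h : polynomial_map g -> polynomial_map h -> polynomial_map (g + h)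
| PolyMul g h : polynomial_map g -> polynomial_map h -> polynomial_map (g * h).

Lemma polynomial_map_differentiable (V : normedModType R) (g : V -> R) x :
  polynomial_map g -> differentiable g x.
Proof.
elim=> [c|l lc|{}g h _ dg _ dh|{}g h _ dg _ dh].
- exact: differentiable_cst.
- exact: linear_differentiable.
- exact: differentiableD.
- exact: differentiableM.
Qed.

Lemma polynomial_map_derive (V : normedModType R) (g : V -> R) v :
  polynomial_map g -> polynomial_map ('D_v g).
Proof.
elim=> [c|l lc|{}g h pg dg ph dh|{}g h pg dg ph dh].
- rewrite (_ : 'D_v _ = cst 0); first exact: PolyCst.
  by apply/funext => x; rewrite derive_cst.
- rewrite (_ : 'D_v _ = cst (l v)); first exact: PolyCst.
  by apply/funext => x; rewrite deriveE ?diff_lin //; exact: linear_differentiable.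
- rewrite (_ : 'D_v _ = 'D_v g + 'D_v h); first exact: PolyAdd.
  apply/funext => x; rewrite deriveD //;
    by apply/diff_derivable/polynomial_map_differentiable.
- rewrite (_ : 'D_v _ = g * 'D_v h + h * 'D_v g).
    by apply: PolyAdd; apply: PolyMul.
  apply/funext => x; rewrite deriveM //;
    by apply/diff_derivable/polynomial_map_differentiable.
Qed.

Lemma smooth_polynomial_map (V : normedModType R) n (F : V -> 'rV[R]_n) :
  (forall i, polynomial_map (fun y => F y 0 i)) -> smooth F.
Proof.
move=> PF vs; suff P i : polynomial_map
    (fun y => (foldr (fun v (g : V -> 'rV[R]_n) => 'D_v g) F vs) y 0 i).
  move=> x; apply: differentiable_coords => i.
  exact: polynomial_map_differentiable.
elim: vs i => [|v vs IH] i //=.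
have -> : (fun y => 'D_v (foldr (fun v (g : V -> 'rV[R]_n) => 'D_v g) F vs) y 0 i) =
    'D_v (fun y => foldr (fun v (g : V -> 'rV[R]_n) => 'D_v g) F vs y 0 i).
  apply/funext => y; rewrite derive_coord //; apply: differentiable_coords => k.
  exact: polynomial_map_differentiable.
exact: polynomial_map_derive.
Qed.

Lemma polynomial_map_sum (V : normedModType R) n (g : 'I_n -> V -> R) :
  (forall i, polynomial_map (g i)) ->
  polynomial_map (fun y => \sum_(i < n) g i y).
Proof.
move=> Pg; rewrite (_ : (fun y => _) = \sum_(i < n) g i); last first.
  by apply/funext => y; rewrite fct_sumE.
by elim/big_ind: _ => //; [exact: PolyCst|exact: PolyAdd].
Qed.

End Calculus.

(** * Response of equilibria *)

Section Response.
Local Open Scope classical_set_scope.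
Variables (R : realType) (n : nat) (G : network n).

Lemma equilibrium_response (f : system R n) X0 I0 (X : R -> 'rV[R]_n) :
  admissible G f -> equilibrium_family f X0 I0 X ->
  input_driven G (jacobian_at f X0 I0) ('D_1 X I0)^T.
Proof.
move=> adm [XI0 Xder Xeq] u ui.
pose V := ('rV[R]_n * R^o)%type.
pose g (z : V) : R := f z.1 z.2 0 u.
have dX : differentiable X I0.
  by apply/derivable1_diffP; exact: nbhs_singleton Xder.
have dg (z : V) : differentiable g z.
  have df : differentiable (fun z : V => f z.1 z.2) z := admissible_smooth adm [::] z.
  have [l lE] : exists l : {linear 'rV[R]_n -> R}, (l : _ -> _) = fun N => N 0 u.
    by apply: linear_function => a M N; rewrite !mxE.
  rewrite (_ : g = l \o (fun z : V => f z.1 z.2)); last by rewrite lE.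
  apply: differentiable_comp => //; apply: linear_differentiable.
  by rewrite lE; exact: coord_continuous.
pose gamma (I : R) : V := (X I, I).
have dgam : differentiable (gamma : R -> V) I0.
  exact: differentiable_pair.
have X0E : gamma I0 = (X0, I0) by rewrite /gamma XI0.
have gX0 : 'd g (X0, I0) ('D_1 X I0, 1) = 0.
  have <- : 'D_1 (g \o gamma) I0 = 0.
    rewrite (@near_eq_derive _ _ _ _ (cst 0)) ?derive_cst //.
    by near=> I; rewrite /g /= (near Xeq) // mxE.
  have dga : 'd (gamma : R -> V) I0 = (fun t => ('d X I0 t, t)) :> (R -> V).
    rewrite diff_pair //.
    by apply/funext => t; rewrite diff_val.
  rewrite [RHS]deriveE; last exact: differentiable_comp.
  by rewrite diff_comp // X0E /= dga deriveE.
have gl l : 'd g (X0, I0) (delta_mx 0 l, 0) = partial f u l X0 I0.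
  rewrite -deriveE // /partial /derive.
  set q1 := (fun h : R => _); set q2 := (fun h : R => _); suff -> : q1 = q2 by [].
  apply/funext => h; rewrite /q1 /q2 /g /=; congr (_ *: (f _ _ _ _ - _)).
  by rewrite scaler0 add0r.
have gI : 'd g (X0, I0) (0, 1) = 0.
  rewrite -deriveE //; apply: (@derive_quadratic _ _ _ _ _ 0 0) => h.
  rewrite /g /= !mulr0 !addr0 scaler0 add0r.
  exact: (admissible_input adm).
have [k kE] : exists k : {linear 'rV[R]_n -> R},
    (k : _ -> _) = fun x => 'd g (X0, I0) (x, 0).
  apply: linear_function => a x y; rewrite -[RHS](linearP ('d g (X0, I0)) a (x, 0) (y, 0)).
  congr ('d g _ _); rewrite [RHS]surjective_pairing /=.
  by rewrite scaler0 addr0.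
have xE : ('D_1 X I0, 1) = ('D_1 X I0, 0) + (0, 1) :> V.
  by rewrite [RHS]surjective_pairing /= addr0 add0r.
have : 'd g (X0, I0) ('D_1 X I0, 1) = k ('D_1 X I0) + 'd g (X0, I0) (0, 1).
  by rewrite xE linearD kE.
rewrite gX0 gI addr0 => /esym.
rewrite [X in k X]row_sum_delta linear_sum mxE => kX.
rewrite -[RHS]kX; apply: eq_bigr => l _.
by rewrite linearZ /= kE gl !mxE mulrC.
Unshelve. all: by end_near. Qed.
End Response.

(** * Realization of a Jacobian *)

Section Realization.
Local Open Scope classical_set_scope.
Variables (R : realType) (n : nat) (G : network n).
Variables (J : 'M[R]_n) (a : R) (v : 'rV[R]_n).
Hypothesis HJ : network_matrix G J.
Implicit Types (X E : 'rV[R]_n) (i l : 'I_n).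

(** Coefficients, not both zero, of a quadratic form in [X l] and [X i] which
    is divisible by [X l] and vanishes at [(v l, v i)].  It makes the node [i]
    depend on [l] even when [J i l = 0], while the line spanned by [v] is not
    affected. *)
Definition quad_coef i l : R * R :=
  if v 0 i == 0 then (0, 1) else (v 0 i, - v 0 l).

Definition quad_term i l X : R :=
  X 0 l * ((quad_coef i l).1 * X 0 l + (quad_coef i l).2 * X 0 i).

Definition proper_arrow i l : R := (arrow G l i && (l != i))%:R.

Definition realization : system R n := fun X I => \row_i
  (\sum_l J i l * X 0 l + a * (i == input G)%:R * I +
   \sum_l proper_arrow i l * quad_term i l X).

Lemma quad_coef_neq0 i l : ((quad_coef i l).1 != 0) || ((quad_coef i l).2 != 0).
Proof.
by rewrite /quad_coef; case: ifPn => [_|vi] /=; rewrite ?oner_eq0 ?eqxx ?vi.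
Qed.

Lemma quad_term_line i l I : quad_term i l (I *: v) = 0.
Proof.
rewrite /quad_term /quad_coef !mxE; case: ifPn => [/eqP ->|_] /=; last by ring.
by rewrite !(mul0r, mulr0, addr0).
Qed.

(** The polar form of the quadratic part of the component [i]. *)
Definition quad_polar i X E : R := \sum_k proper_arrow i k *
  (E 0 k * ((quad_coef i k).1 * X 0 k + (quad_coef i k).2 * X 0 i) +
   X 0 k * ((quad_coef i k).1 * E 0 k + (quad_coef i k).2 * E 0 i)).

Lemma partial_realization i l X I :
  partial realization i l X I = J i l + quad_polar i X (delta_mx 0 l).
Proof.
set E := delta_mx 0 l.
apply: (@derive_quadratic _ _ _ _ _ _ (\sum_k proper_arrow i k * quad_term i k E)) => h.
rewrite !mxE; have -> : J i l = \sum_k J i k * E 0 k.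
  rewrite (bigD1 l) //= mxE !eqxx mulr1 big1 ?addr0 // => k kl.
  by rewrite mxE (negPf kl) andbF mulr0.
have -> : \sum_k J i k * (h *: E + X) 0 k =
    \sum_k J i k * X 0 k + h * \sum_k J i k * E 0 k.
  by rewrite mulr_sumr -big_split /=; apply: eq_bigr => k _; rewrite !mxE; ring.
have -> : \sum_k proper_arrow i k * quad_term i k (h *: E + X) =
    \sum_k proper_arrow i k * quad_term i k X + h * quad_polar i X E +
    h ^+ 2 * \sum_k proper_arrow i k * quad_term i k E.
  rewrite !mulr_sumr -!big_split /=; apply: eq_bigr => k _.
  by rewrite /quad_term ![(_ + X) 0 _]mxE ![(h *: E) 0 _]mxE; ring.
by ring.
Qed.

Lemma jacobian_realization I : jacobian_at realization 0 I = J.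
Proof.
apply/matrixP => i l; rewrite mxE partial_realization /quad_polar big1 ?addr0 // => k _.
by rewrite [(0 : 'rV_n) 0 _]mxE [(0 : 'rV_n) 0 i]mxE !(mulr0, mul0r, addr0).
Qed.

Lemma quad_polar_delta i l X : i != l -> quad_polar i X (delta_mx 0 l) =
  proper_arrow i l * (2 * (quad_coef i l).1 * X 0 l + (quad_coef i l).2 * X 0 i).
Proof.
move=> il; rewrite /quad_polar (bigD1 l) //= !mxE !eqxx (negPf il) /=.
rewrite big1 => [|k kl]; first by ring.
by rewrite !mxE (negPf kl) /=; ring.
Qed.

Lemma input_derivative_realization X I : input_derivative G realization X I = a.
Proof.
rewrite /input_derivative derive1E; apply: (@derive_quadratic _ _ _ _ _ _ 0) => h.
rewrite !mxE eqxx [h *: _]mulr1 /=. ring.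
Qed.

Lemma realization_smooth :
  smooth (fun z : ('rV[R]_n * R^o)%type => realization z.1 z.2).
Proof.
apply: smooth_polynomial_map => i.
pose V := ('rV[R]_n * R^o)%type.
have P1 l : polynomial_map (fun z : V => z.1 0 l).
  have [k kE] : exists k : {linear V -> R}, (k : _ -> _) = fun z => z.1 0 l.
    by apply: linear_function => b x y; rewrite !mxE.
  rewrite -kE; apply: PolyLin; rewrite kE => z.
  apply: (@continuous_comp _ _ _ (fst : V -> _) (fun N : 'rV[R]_n => N 0 l)).
    exact: cvg_fst.
  exact: coord_continuous.
have P2 : polynomial_map (fun z : V => z.2).
  have [k kE] : exists k : {linear V -> R}, (k : _ -> _) = fun z => z.2.
    by apply: linear_function.
  by rewrite -kE; apply: PolyLin; rewrite kE => z; exact: cvg_snd.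
have Pc c (g : V -> R) : polynomial_map g -> polynomial_map (fun z => c * g z).
  exact: (PolyMul (PolyCst _ c)).
rewrite (_ : (fun z => _) = (fun z : V => \sum_l J i l * z.1 0 l) +
   (fun z => a * (i == input G)%:R * z.2) +
   (fun z => \sum_l proper_arrow i l * quad_term i l z.1)); last first.
  by apply/funext => z; rewrite mxE.
apply: PolyAdd; first apply: PolyAdd.
- by apply: polynomial_map_sum => l; apply: Pc.
- exact: Pc.
- apply: polynomial_map_sum => l; apply: (Pc); apply: (PolyMul (P1 l)).
  by apply: PolyAdd; apply: Pc.
Qed.

Lemma realization_admissible : admissible G realization.
Proof.
split; first exact: realization_smooth.
- by move=> i X I I' ii; rewrite !mxE (negPf ii) !mulr0 !mul0r.
- move=> i X Y I XY; rewrite !mxE; congr (_ + _ + _).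
    apply: eq_bigr => l _; have [il|il] := boolP (nonzero_entry G i l).
      by rewrite XY.
    by rewrite HJ // !mul0r.
  apply: eq_bigr => l _; rewrite /proper_arrow.
  case: (boolP (arrow G l i && (l != i))) => [/andP[li _]|_]; last by rewrite !mul0r.
  by rewrite /quad_term !XY // /nonzero_entry ?eqxx // li orbT.
- move=> i l il; split=> [p0|nli X I].
    apply/negP => li.
    have w1 : proper_arrow i l = 1 by rewrite /proper_arrow li eq_sym il.
    have pE X : J i l + (2 * (quad_coef i l).1 * X 0 l + (quad_coef i l).2 * X 0 i) = 0.
      by rewrite -[RHS](p0 X 0) partial_realization quad_polar_delta // w1 mul1r.
    have J0 : J i l = 0 by have := pE 0; rewrite !mxE !mulr0 !addr0.
    have q2 : (quad_coef i l).2 = 0.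
      by have := pE (delta_mx 0 i); rewrite J0 !mxE !eqxx eq_sym (negPf il) /= mulr0 mulr1 !add0r.
    have /eqP := pE (delta_mx 0 l); rewrite J0 q2 !mxE !eqxx mul0r addr0 add0r mulr1.
    rewrite mulf_eq0 pnatr_eq0 /= => q1.
    by have := quad_coef_neq0 i l; rewrite q1 q2 eqxx.
  rewrite partial_realization HJ; last by rewrite negb_or il nli.
  by rewrite quad_polar_delta // /proper_arrow (negPf nli) mul0r addr0.
Qed.

Hypothesis Jv : forall i, (J *m v^T) i 0 = - a * (i == input G)%:R.

Lemma realization_family : equilibrium_family realization 0 0 (fun I => I *: v).
Proof.
split; first by rewrite scale0r.
  near=> I; apply: diff_derivable; apply: differentiableZl.
  by [].
near=> I; apply/rowP => i; rewrite !mxE.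
rewrite [X in _ + X]big1 ?addr0 => [|l _]; last by rewrite quad_term_line mulr0.
have -> : \sum_l J i l * (I *: v) 0 l = I * (J *m v^T) i 0.
  by rewrite mxE mulr_sumr; apply: eq_bigr => l _; rewrite !mxE; ring.
by rewrite Jv; ring.
Unshelve. all: by end_near. Qed.

Lemma realization_response k : homeostatic realization 0 0 k -> v 0 k = 0.
Proof.
move=> /(_ _ realization_family) <-; rewrite derive1E; apply/esym.
apply: (@derive_quadratic _ _ _ _ _ _ 0) => h.
by rewrite !mxE [h *: _]mulr1; ring.
Qed.

End Realization.

(** * Induction of homeostasis *)

Section Induction.
Variables (R : realType) (n : nat) (G : network n).

Lemma jacobian_network_matrix (f : system R n) X0 I0 :
  admissible G f -> network_matrix G (jacobian_at f X0 I0).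
Proof.
move=> adm i l; rewrite negb_or => /andP[il nli]; rewrite mxE.
exact: (admissible_partial adm il).2.
Qed.

(** No exceptional set is needed, so the polynomial can be the constant 1; it
    is then nonzero at the zero matrix, whose block is singular. *)
Lemma class_block_induces m c v : matching G m -> c != output G ->
  ~~ connect (depends G m) c v -> block_induces R G (class_block G m c) v.
Proof.
move=> Hm co cv; exists (mpoly.mpolyC _ 1); split.
  exists 0, 0; split=> [i l _||]; first by rewrite mxE.
    apply/(block_det_eq0P _ (card_class_block Hm c)); exists (delta_mx c 0).
      by apply/eqP => /matrixP/(_ c 0); rewrite !mxE !eqxx /=; apply/eqP; rewrite oner_eq0.
    split=> [x xK|u _]; last by rewrite mul0mx mxE.
    by rewrite mxE andbT; case: eqP xK => // ->; rewrite class_refl.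
  by rewrite /eval_partials mpoly.mevalC oner_eq0.
move=> f X0 I0 adm hyp B0 _ X famX.
have := singular_class_response Hm (jacobian_network_matrix X0 I0 adm)
  (hyperbolic_unitmx hyp) co B0 (equilibrium_response adm famX) cv.
have [_ Xder _] := famX.
rewrite mxE derive1E derive_coord //.
by apply/derivable1_diffP; exact: nbhs_singleton Xder.
Qed.

Section Upstream.
Variables (q : nat) (rho : 'I_q.+2 -> 'I_n).
Hypotheses (hcore : core G) (hrho : super_simple_order G rho).
Variables (m : 'I_n -> 'I_n) (j : 'I_q.+1).
Hypothesis Hm : matching G m.

Lemma class_block_not_induces (k : 'I_q.+2) : (k <= j)%N ->
  ~ block_induces R G (class_block G m (rho_pred rho j)) (rho k).
Proof.
move=> kj [P [[J0 [a0 [HJ0 B0 P0]]] ind]].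
have [J [a [HJ B P1 ly resp]]] := generic_point hcore hrho Hm kj HJ0 B0 P0.
have Ju := lyapunov_unitmx ly.
pose v : 'rV[R]_n := (- a *: (invmx J *m delta_mx (input G) (0 : 'I_1)))^T.
have Jv i : (J *m v^T) i 0 = - a * (i == input G)%:R.
  by rewrite trmxK -scalemxAr mulKVmx // !mxE andbT.
have vk : v 0 (rho k) != 0.
  rewrite /v mxE [X in X != 0]mxE -colE mulf_eq0 negb_or oppr_eq0.
  move: resp; rewrite mulf_eq0 negb_or => /andP[-> adj0] /=.
  rewrite mxE /invmx Ju mxE mulf_neq0 // invr_eq0.
  by move: Ju; rewrite unitmxE unitfE.
move/eqP: vk; apply.
apply: (realization_response Jv); apply: ind.
- exact: realization_admissible.
- split; first by have [_ _ /nbhs_singleton] := realization_family Jv; rewrite scale0r.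
  by rewrite jacobian_realization; exact: lyapunov_hyperbolic.
- by rewrite /homeostasis_inducing jacobian_realization.
- by rewrite jacobian_realization input_derivative_realization.
Qed.

(** The class of [rho_j] lies in the closed set of the nodes reached without
    visiting [rho_(j+1)], and no later super-simple node does. *)
Lemma rho_unreachable (k : 'I_q.+2) : (j < k)%N ->
  ~~ connect (depends G m) (rho_pred rho j) (rho k).
Proof.
move=> jk; have sA := avoiding_stable Hm (super_simple_rho hrho (lift ord0 j)) hcore.
apply/negP => /(connect_stable sA).
by rewrite !(rho_avoiding hcore hrho) /= /bump add1n ltnS leqnn => /(_ isT); rewrite ltnS leqNgt jk.
Qed.

End Upstream.
End Induction.

Theorem theorem2p17 (R : realType) (n : nat) (G : network n) (q : nat)
    (rho : 'I_q.+2 -> 'I_n) (hcore : core G) (hrho : super_simple_order G rho)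
    (j : 'I_q.+1) (v : pattern_node q) :
  backbone_induces R G rho j v <-> strictly_downstream v (Backbone j).
Proof.
have [p ip] := core_io_simple_path hcore; have Hm := next_matching ip.
have not_upstream (k : 'I_q.+2) : induces R G (structural_subnetwork G rho j) (rho k) -> (j < k)%N.
  move=> [B [hB nodes ind]]; rewrite ltnNge; apply/negP => kj.
  apply: (class_block_not_induces (R := R) hcore hrho Hm kj).
  by rewrite -(structural_block hcore hrho Hm hB nodes).
have downstream u : ~~ connect (depends G (next p)) (rho_pred rho j) u ->
    induces R G (structural_subnetwork G rho j) u.
  move=> ju; have ao := rho_pred_output hcore hrho j.
  exists (class_block G (next p) (rho_pred rho j)); split.
  - exact: class_homeostasis_block.
  - move=> w; rewrite (structural_subnetwork_class hcore hrho j Hm).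
    exact: block_nodes_class.
  - exact: class_block_induces.
case: v => [k|k]; rewrite /strictly_downstream /=.
  rewrite (_ : (j.*2.+1 < k.*2)%N = (j < k)%N); last by lia.
  split=> [/not_upstream //|jk]; apply: downstream.
  exact: rho_unreachable.
rewrite (_ : (j.*2.+1 < k.*2.+1)%N = (j < k)%N); last by lia.
split=> [ind|jk u].
  by apply: (not_upstream (widen_ord (leqnSn q.+1) k)); apply: ind; apply: Or31.
rewrite (structural_subnetwork_class hcore hrho k Hm) (class_rows hcore hrho k Hm) => uk.
apply: downstream.
have [uK|/eqP ->] : u \in class G (next p) (rho_pred rho k) \/ u == rho_succ rho k.
  by case: uk => [|/orP[|/andP[]]]; auto.
  apply: contraNN (rho_unreachable hcore hrho Hm (k := widen_ord (leqnSn q.+1) k) jk) => ju.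
  by apply: connect_trans ju _; move: uK; rewrite inE => /andP[].
by apply: rho_unreachable => //=; rewrite /bump add1n ltnS ltnW.
Qed.
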